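(* Let $F$ be a non-Archimedean local field and $E=F\times E'$ with $E'/F$ a ramified quadratic field extension with uniformizer $x$. For integers $a,b\ge0$ and $c\in\mathfrak o$ let $\mathcal O_{a,b,c}$ be the $\mathfrak o$-submodule of $F\times E'$ generated by $(1,1)$, $(0,\pi^a)$, $(0,\pi^bx+c)$. Then: (1) Every order of $E$ is of the form $\mathcal O_{a,b,c}$ with $a\le\min(2b+1,2\,\mathrm{ord}(c))$. Conversely, an $\mathfrak o$-module $\mathcal O_{a,b,c}$ with $a\le\min(2b+1,2\,\mathrm{ord}(c))$ is an order. (2) An order $\mathcal O_{a',b',c'}$ contains an order $\mathcal O_{a,b,c}$ if and only if $a'\le a$, $b'\le b$, and $$\begin{cases}c'\in(\pi^{\max(\lceil a'/2\rceil,\,a'-(b-b'))}) & \text{if }\mathrm{ord}(c)\ge a';\\ c'-\pi^{-(b-b')}c\in(\pi^{a'-(b-b')}) & \text{if }\mathrm{ord}(c)<a'.\end{cases}$$ In the second case, $\lceil a'/2\rceil\le\mathrm{ord}(c)-(b-b')=\mathrm{ord}(c')$ (and thus $a'-(b-b')>0$). (3) Two orders $\mathcal O_{a',b',c'}$ and $\mathcal O_{a,b,c}$ are equal if and only if $a=a'$, $b=b'$ and $c-c'\in(\pi^a)$. (4) For an order $\mathcal O_{a,b,c}$, $S(\mathcal O_{a,b,c})=a+b$ and the conductor is $\mathfrak f(\mathcal O_{a,b,c})=(\pi^a)\times\bigl(x^{\max(2a,\,2b+1,\,2a+2b-2\mathrm{ord}(c)+1)-1}\bigr)$ as an ideal of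 $\mathcal O_E=\mathfrak o\times\mathfrak o[x]$. (5) An order $\mathcal O_{a,b,c}$ is Gorenstein if and only if $$\begin{cases}a=2b+1\text{ or }a=0 & \text{if }\mathrm{ord}(c)\ge a;\\ a=\min(2b+1,2\,\mathrm{ord}(c)) & \text{if }\mathrm{ord}(c)<a.\end{cases}$$
   Context: $F$ has any characteristic, ring of integers $\mathfrak o$, uniformizer $\pi$; $\mathrm{ord}$ is the normalized valuation of $F$ with $\mathrm{ord}(0)=\infty$. For $j\in\mathbb Z$, $(\pi^j)=\pi^j\mathfrak o\subset F$ in (2) (conditions are read in $F$). $\mathcal O_{E'}=\mathfrak o[x]$ is the ring of integers of $E'$. The maximal order of $E$ is $\mathcal O_E=\mathfrak o\times\mathcal O_{E'}$. An order of $E$ is a subring $\mathcal O\subset E$ containing $\mathfrak o$ (diagonally), finitely generated as an $\mathfrak o$-module, with $F\mathcal O=E$. $S(\mathcal O)$ is the $\mathfrak o$-length of $\mathcal O_E/\mathcal O$; $\mathfrak f(\mathcal O)=\{a\in\mathcal O_E:a\mathcal O_E\subset\mathcal O\}$. A fractional $\mathcal O$-ideal is a finitely generated $\mathcal O$-submodule $I\subset E$ with $FI=E$; it is invertible if $IJ=\mathcal O$ for some fractional ideal $J$. $\mathcal O$ is Gorenstein if every fractional $\mathcal O$-ideal $I$ with $\{y\in E:yI\subset I\}=\mathcal O$ is invertible. *)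

(* Defs.v *)
From mathcomp Require Import all_boot all_order all_algebra all_field.
From mathcomp Require Import boolp classical_sets constructive_ereal.

Set Implicit Arguments.
Unset Strict Implicit.
Unset Printing Implicit Defensive.

Import Order.TTheory GRing.Theory Num.Theory.
Local Open Scope classical_set_scope.
Local Open Scope ring_scope.

(* Valuations take values in \bar int; the value -oo is never attained. *)
Definition normalized_valuation (K : fieldType) (v : K -> \bar int) : Prop :=
  [/\ v 0 = +oo%E,
      forall y, y != 0 -> v y \is a fin_num,
      forall y z, v (y * z)%R = (v y + v z)%E,
      forall y z, (Order.min (v y) (v z) <= v (y + z)%R)%E &
      exists y, v y = 1%:E].

Definition valuation_complete (K : fieldType) (v : K -> \bar int) : Prop :=
  forall u : nat -> K,
    (forall N : int, exists n0 : nat, forall m n : nat,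
       (n0 <= m)%N -> (n0 <= n)%N -> (N%:E <= v (u m - u n)%R)%E) ->
    exists l : K, forall N : int, exists n0 : nat, forall n : nat,
       (n0 <= n)%N -> (N%:E <= v (u n - l)%R)%E.

Definition valuation_ring (K : fieldType) (v : K -> \bar int) : set K :=
  [set y | (0 <= v y)%E].

(* s contains a representative of every class modulo the maximal ideal. *)
Definition finite_residue_field (K : fieldType) (v : K -> \bar int) : Prop :=
  exists s : seq K, forall y, valuation_ring v y ->
    exists2 z, z \in s & (0 < v (y - z)%R)%E.

Definition nonarchimedean_local_field (K : fieldType) (v : K -> \bar int) :
  Prop :=
  [/\ normalized_valuation v, valuation_complete v & finite_residue_field v].

Definition uniformizer (K : fieldType) (v : K -> \bar int) (t : K) : Prop :=
  v t = 1%:E.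

(* w extends v up to the ramification index e > 1.  As F is complete, w is
   then the only normalized valuation of L extending v. *)
Definition ramified (F : fieldType) (v : F -> \bar int)
    (L : fieldExtType F) (w : L -> \bar int) : Prop :=
  normalized_valuation w /\
  exists e : nat, (1 < e)%N /\ forall y : F, w y%:A = (e%:Z%:E * v y)%E.

Definition principal_ideal (R : nzRingType) (A : set R) (u : R) : set R :=
  [set u * y | y in A].

Definition submodule (R : nzRingType) (A M : set R) : Prop :=
  zmod_closed [in M] /\ forall r u, A r -> M u -> M (r * u).

Definition generated (R : nzRingType) (A S : set R) : set R :=
  smallest (submodule A) S.

Definition finitely_generated (R : nzRingType) (A M : set R) : Prop :=
  exists s : seq R, M = generated A [set` s].

(* The length of M / N, as the largest length of a chain of A-submodules
   of M / N, that is, of A-submodules lying between N and M. *)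
Definition submodule_chain (R : nzRingType) (A N M : set R) (n : nat)
    (L : nat -> set R) : Prop :=
  [/\ L 0%N = N, L n = M,
      forall i, (i <= n)%N -> submodule A (L i) &
      forall i, (i < n)%N -> L i `<` L i.+1].

Definition quotient_length (R : nzRingType) (A M N : set R) (n : nat) : Prop :=
  (exists L, submodule_chain A N M n L) /\
  (forall m L, submodule_chain A N M m L -> (m <= n)%N).

(* The image in E of a set of scalars; subrings of F act on E through it. *)
Definition scalars (F : fieldType) (E : lalgType F) (A : set F) : set E :=
  [set y%:A | y in A].
Arguments scalars {F} E A.

Definition spans (F : fieldType) (E : lalgType F) (M : set E) : Prop :=
  generated (scalars E [set: F]) M = [set: E].

Definition is_order (F : fieldType) (v : F -> \bar int) (E : lalgType F)
    (O : set E) : Prop :=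
  [/\ subring_closed [in O],
      scalars E (valuation_ring v) `<=` O,
      finitely_generated (scalars E (valuation_ring v)) O &
      spans O].

Definition fractional_ideal (F : fieldType) (E : lalgType F) (O I : set E) :
  Prop := [/\ submodule O I, finitely_generated O I & spans I].

Definition ideal_mul (R : nzRingType) (O I J : set R) : set R :=
  generated O [set u * w | u in I & w in J].

Definition invertible_ideal (F : fieldType) (E : lalgType F) (O I : set E) :
  Prop := exists J, fractional_ideal O J /\ ideal_mul O I J = O.

Definition multiplier_ring (R : nzRingType) (I : set R) : set R :=
  [set y | forall u, I u -> I (y * u)].

Definition gorenstein (F : fieldType) (E : lalgType F) (O : set E) : Prop :=
  forall I, fractional_ideal O I -> multiplier_ring I = O ->
    invertible_ideal O I.

Definition conductor (R : nzRingType) (OE O : set R) : set R :=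
  [set u | OE u /\ forall w, OE w -> O (u * w)].

(* F^o is F as an algebra over itself, which makes the product an F-algebra. *)
Notation prod_alg F L := (F^o * L)%type.

Definition max_order (F : fieldType) (v : F -> \bar int)
    (L : fieldExtType F) (w : L -> \bar int) : set (prod_alg F L) :=
  valuation_ring v `*` valuation_ring w.

Definition Oabc (F : fieldType) (v : F -> \bar int) (L : fieldExtType F)
    (pi : F) (x : L) (a b : nat) (c : F) : set (prod_alg F L) :=
  generated (scalars (prod_alg F L) (valuation_ring v))
    [set` [:: (1, 1); (0, (pi ^+ a)%:A); (0, pi ^+ b *: x + c%:A)]].

(* Main.v *)
(* Write x^2 = t x - n with v(t) >= 1 and v(n) = 1, and (p, q + r x) for the
   elements of E.  Then O_{a,b,c} is given by v(p) >= 0, v(r) >= b and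
   v(q - p - r pi^-b c) >= a, which yields all inclusions.  Every spanning
   o-module between o and O_E has this form, so chains of modules are counted
   by a + b.  With N the norm of pi^b x + c, so that
   v(N) = min(2 b + 1, 2 v(c)), the module O_{a,b,c} is a ring iff v(N) >= a;
   if v(N) = a - k with k > 0, its multiplier ring is O_{a,b+k,pi^k c}, for which the
   norm has valuation a + k > a.  A fractional ideal, divided by an element
   minimising both valuations, becomes some O_{a,b,c}; hence an order has a
   noninvertible ideal with itself as multiplier ring iff v(N) > a > 0. *)

Require Import Defs.
From mathcomp Require Import all_boot all_order all_algebra all_field.
From mathcomp Require Import boolp classical_sets constructive_ereal.
From mathcomp Require Import zify ring.

Set Implicit Arguments.
Unset Strict Implicit.
Unset Printing Implicit Defensive.

Import Order.TTheory GRing.Theory Num.Theory.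
Local Open Scope classical_set_scope.
Local Open Scope ring_scope.

(** Ramification keeps the coordinates q and r apart: 2 v(q) is even and 2 v(r) + 1 is odd, so q and
    r x never cancel, whatever the residue characteristic. The hypothesis [ramified] gives only some
    index e > 1; that e = 2 is read off from w(x^2) = 2. Bounds are phrased by the predicate [vge],
    which holds for 0 at every threshold and shifts under multiplication. For the Gorenstein
    criterion two obstacles remain. The order determines c only modulo pi^a, so v(N) > a must not
    depend on the choice of c. And the exhibited ideal must be shown noninvertible: for a > 0 the
    order is local, so an inverse of an ideal I containing 1 would contain a unit of the order,
    which would force I into the order itself. *)

Definition vge (K : fieldType) (v : K -> \bar int) (k : int) (y : K) : bool :=
  (k%:E <= v y)%E.

(** * Discrete valuations *)

Section Valuation.
Variables (K : fieldType) (v : K -> \bar int).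
Hypothesis hv : normalized_valuation v.

Lemma valuation0 : v 0 = +oo%E.
Proof. by case: hv. Qed.

Lemma val_fin y : y != 0 -> exists k : int, v y = k%:E.
Proof.
by case: hv => _ h _ _ _ /h; case: (v y) => // r _; exists r.
Qed.

Lemma valuationM y z : v (y * z) = (v y + v z)%E.
Proof. by case: hv. Qed.

Lemma val_neq0 y k : v y = k%:E -> y != 0.
Proof. by move=> h; apply/eqP=> y0; move: h; rewrite y0 valuation0. Qed.

Lemma valuation1 : v 1 = 0%:E.
Proof.
have [k hk] : exists k : int, v 1 = k%:E by apply: val_fin; apply: oner_neq0.
have := valuationM 1 1; rewrite mulr1 hk -EFinD => -[] e.
by congr _%:E; lia.
Qed.

Lemma valuationN1 : v (-1) = 0%:E.
Proof.
have [k hk] : exists k : int, v (-1) = k%:E.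
  by apply: val_fin; rewrite oppr_eq0 oner_neq0.
have := valuationM (-1) (-1); rewrite mulrNN mulr1 valuation1 hk -EFinD => -[] e.
by congr _%:E; lia.
Qed.

Lemma valuationN y : v (- y) = v y.
Proof. by rewrite -mulN1r valuationM valuationN1 add0e. Qed.

Lemma valuationV y k : v y = k%:E -> v y^-1 = (- k)%:E.
Proof.
move=> hy; have y0 := val_neq0 hy.
have [l hl] : exists l : int, v y^-1 = l%:E by apply: val_fin; rewrite invr_eq0.
have := valuationM y y^-1; rewrite divff // valuation1 hy hl -EFinD => -[] e.
by congr _%:E; lia.
Qed.

Lemma valuationXn y (k : int) n : v y = k%:E -> v (y ^+ n) = (k * n%:Z)%:E.
Proof.
move=> hy; elim: n => [|n IH]; first by rewrite expr0 valuation1 mulr0.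
by rewrite exprS valuationM hy IH -EFinD; congr _%:E; lia.
Qed.

Lemma vge_0 k : vge v k 0.
Proof. by rewrite /vge valuation0 leey. Qed.

Lemma vgeN k y : vge v k (- y) = vge v k y.
Proof. by rewrite /vge valuationN. Qed.

Lemma vgeD k y z : vge v k y -> vge v k z -> vge v k (y + z).
Proof.
move=> hy hz; case: hv => _ _ _ h _; apply: le_trans (h y z).
by rewrite le_min; apply/andP.
Qed.

Lemma vgeB k y z : vge v k y -> vge v k z -> vge v k (y - z).
Proof. by move=> hy hz; apply: vgeD => //; rewrite vgeN. Qed.

Lemma vgeBC k y z : vge v k (y - z) = vge v k (z - y).
Proof. by rewrite -opprB vgeN. Qed.

Lemma vge_le k l y : vge v k y -> (l <= k) -> vge v l y.
Proof. by move=> h lk; apply: le_trans h; rewrite lee_fin. Qed.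

Lemma vge_max (k l : int) y : vge v (Order.max k l) y = vge v k y && vge v l y.
Proof.
have [kl|lk] := leP k l; apply/idP/andP => [h|[]] //; split=> //.
  exact: vge_le kl.
by apply: vge_le h _; apply: ltW.
Qed.

Lemma vgeE k l y : v y = k%:E -> vge v l y = (l <= k).
Proof. by rewrite /vge => ->; rewrite lee_fin. Qed.

Lemma vgeM k l y z : vge v k y -> vge v l z -> vge v (k + l) (y * z).
Proof. by move=> hy hz; rewrite /vge valuationM EFinD; apply: leeD. Qed.

Lemma vgeMl k y z : vge v 0 y -> vge v k z -> vge v k (y * z).
Proof. by move=> hy hz; rewrite -[k]add0r; apply: vgeM. Qed.

Lemma vge_1 : vge v 0 1.
Proof. by rewrite (vgeE _ valuation1). Qed.

Lemma vge_mull k l y z : v y = k%:E -> vge v l (y * z) = vge v (l - k) z.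
Proof. by move=> hy; rewrite /vge valuationM hy addeC -leeBlDr. Qed.

Lemma vge_mulr k l y z : v y = k%:E -> vge v l (z * y) = vge v (l - k) z.
Proof. by move=> hy; rewrite mulrC; apply: vge_mull. Qed.

Lemma vge_addl k y z : vge v k y -> vge v k (y + z) = vge v k z.
Proof.
move=> hy; apply/idP/idP => h; last exact: vgeD.
by rewrite -[z](addKr y); apply: vgeD => //; rewrite vgeN.
Qed.

Lemma vge_addr k y z : vge v k y -> vge v k (z + y) = vge v k z.
Proof. by move=> hy; rewrite addrC; apply: vge_addl. Qed.

Lemma val_eq (k : int) y : vge v k y -> ~~ vge v (k + 1) y -> v y = k%:E.
Proof.
rewrite /vge; case: (v y) => [r| |]; rewrite ?leey // !lee_fin => h1 h2.
by congr _%:E; lia.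
Qed.

Lemma val_addl (k : int) y z : v y = k%:E -> vge v (k + 1) z -> v (y + z) = k%:E.
Proof.
move=> hy hz; apply: val_eq.
  by apply: vgeD; [rewrite (vgeE _ hy) | apply: vge_le hz _; lia].
by rewrite vge_addr // (vgeE _ hy); lia.
Qed.

Lemma val_cases y : y = 0 \/ exists k : int, v y = k%:E.
Proof. by have [->|/val_fin] := eqVneq y 0; [left | right]. Qed.

Lemma vge_bounded y : exists k : nat, vge v (- k%:Z) y.
Proof.
have [->|[k hk]] := val_cases y; first by exists 0%N; apply: vge_0.
by exists `|k|%N; rewrite (vgeE _ hk); lia.
Qed.

Lemma vge_all y : (forall k : nat, vge v k%:Z y) -> y = 0.
Proof.
move=> h; have [//|[k hk]] := val_cases y.
by have := h `|k|.+1%N; rewrite (vgeE _ hk); lia.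
Qed.

(** A negative valuation is multiplied by the exponent and leaves every bound. This is the
    integrality argument for elements of orders, whose powers have bounded denominators. *)
Lemma vge_powers k y : (forall n, vge v (- k) (y ^+ n)) -> vge v 0 y.
Proof.
move=> h; have [->|[m hm]] := val_cases y; first exact: vge_0.
rewrite (vgeE _ hm); have := h `|k|.+1%N; rewrite (vgeE _ (valuationXn _ hm)).
by nia.
Qed.

Lemma val_min (S : set K) (k : int) : (forall y, S y -> vge v (- k) y) ->
  (exists2 y, S y & y != 0) ->
  exists y m, [/\ S y, v y = m%:E & forall z, S z -> vge v m z].
Proof.
move=> hS [y0 Sy0 y00].
(* Adding k turns the valuations attained on S into natural numbers, among which there is a least
   one. *)
pose P (j : nat) := `[< exists2 y, S y & v y = (j%:Z - k)%:E >].
have toP y : S y -> y != 0 -> exists2 j : nat, v y = (j%:Z - k)%:E & P j.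
  move=> Sy /val_fin [j hj]; have := hS y Sy; rewrite (vgeE _ hj) => le.
  have e : j = Posz (absz (j + k)) - k by lia.
  have hj' : v y = (Posz (absz (j + k)) - k)%:E by rewrite -e.
  by exists (absz (j + k)) => //; apply/asboolP; exists y.
have exP : exists j, P j by have [j _ hj] := toP y0 Sy0 y00; exists j.
case: (ex_minnP exP) => j /asboolP [y Sy hy] jmin.
exists y, (j%:Z - k); split=> // z Sz.
have [->|/(toP z Sz) [i hi /jmin ij]] := eqVneq z 0; first exact: vge_0.
by rewrite (vgeE _ hi); lia.
Qed.

Section Uniformizer.
Variable t : K.
Hypothesis ht : uniformizer v t.

Lemma unif_neq0 : t != 0.
Proof. exact: val_neq0 ht. Qed.

Lemma val_expn n : v (t ^+ n) = n%:Z%:E.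
Proof. by rewrite (valuationXn _ ht) mul1r. Qed.

Lemma val_expz (j : int) : v (t ^ j) = j%:E.
Proof.
case: j => n; first exact: val_expn.
by rewrite NegzE; apply: valuationV; apply: val_expn.
Qed.

Lemma principal_idealE (j : int) :
  principal_ideal (valuation_ring v) (t ^ j) = [set y | vge v j y].
Proof.
apply/seteqP; split => y /=.
  move=> [z hz <-]; rewrite (vge_mull _ _ (val_expz j)) subrr; exact: hz.
move=> hy; exists (t ^ (- j) * y).
  by rewrite /valuation_ring /= -/(vge v 0 _) (vge_mull _ _ (val_expz _)) opprK add0r.
by rewrite mulrA -expfzDr ?unif_neq0 // subrr expr0z mul1r.
Qed.

End Uniformizer.
End Valuation.

(** * Submodules and lattices *)

Section Submodules.
Variables (R : nzRingType) (A : set R).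

Lemma submoduleP M : M 0 -> (forall u w, M u -> M w -> M (u - w)) ->
  (forall r u, A r -> M u -> M (r * u)) -> submodule A M.
Proof.
move=> h0 hB hM; split=> //; split; first by rewrite inE.
by move=> u w; rewrite !inE; apply: hB.
Qed.

Lemma submod0 M : submodule A M -> M 0.
Proof. by case=> -[]; rewrite inE. Qed.

Lemma submodB M u w : submodule A M -> M u -> M w -> M (u - w).
Proof. by case=> -[_ h] _ hu hw; have := h u w; rewrite !inE; apply. Qed.

Lemma submodN M u : submodule A M -> M u -> M (- u).
Proof. by move=> hM hu; rewrite -sub0r; apply: submodB => //; apply: submod0. Qed.

Lemma submodD M u w : submodule A M -> M u -> M w -> M (u + w).
Proof. by move=> hM hu hw; rewrite -[w]opprK; apply: submodB => //; apply: submodN. Qed.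

Lemma submodM M r u : submodule A M -> A r -> M u -> M (r * u).
Proof. by case=> _; apply. Qed.

Lemma generated_submodule S : submodule A (generated A S).
Proof.
apply: submoduleP => [|u w hu hw|r u hr hu] M [hM hS].
- exact: submod0.
- by apply: submodB; [|apply: hu|apply: hw].
- by apply: submodM => //; apply: hu.
Qed.

Lemma sub_generated S : S `<=` generated A S.
Proof. exact: sub_gen_smallest. Qed.

Lemma generated_sub S M : submodule A M -> S `<=` M -> generated A S `<=` M.
Proof. exact: smallest_sub. Qed.

End Submodules.

Lemma submodule_trans (R : nzRingType) (A B M : set R) :
  A `<=` B -> submodule B M -> submodule A M.
Proof.
move=> AB hM; apply: submoduleP; first exact: submod0 hM.
  by move=> u w; apply: submodB hM.
by move=> r u /AB; apply: submodM.
Qed.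

Section Lattices.
Variables (F : fieldType) (v : F -> \bar int) (pi : F) (E : algType F).
Hypotheses (hv : normalized_valuation v) (hpi : uniformizer v pi).
Let o := valuation_ring v.

Lemma submodule_scalarsP (A : set F) (M : set E) : M 0 ->
  (forall u w, M u -> M w -> M (u - w)) ->
  (forall r u, A r -> M u -> M (r *: u)) -> submodule (scalars E A) M.
Proof.
by move=> h0 hB hZ; apply: submoduleP => // _ u [r hr <-]; rewrite mulr_algl; apply: hZ.
Qed.

Lemma submodZ (A : set F) (M : set E) r u :
  submodule (scalars E A) M -> A r -> M u -> M (r *: u).
Proof. by move=> hM hr hu; rewrite -mulr_algl; apply: (submodM hM) => //; exists r. Qed.

Lemma generated3P (e1 e2 e3 u : E) :
  generated (scalars E o) [set` [:: e1; e2; e3]] u <->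
  exists l m n, [/\ vge v 0 l, vge v 0 m, vge v 0 n &
                    u = l *: e1 + m *: e2 + n *: e3].
Proof.
set G := generated _ _; have hG : submodule _ G := generated_submodule _ _.
split; last first.
  move=> [l [m [n [hl hm hn ->]]]].
  by apply: (submodD hG); [apply: (submodD hG)|]; apply: (submodZ hG) => //;
    apply: sub_generated; rewrite /= !inE eqxx ?orbT.
apply: (@generated_sub _ _ _ [set u | exists l m n, [/\ vge v 0 l, vge v 0 m, vge v 0 n &
                    u = l *: e1 + m *: e2 + n *: e3]]).
  apply: submodule_scalarsP.
  - by exists 0, 0, 0; rewrite !vge_0 // !scale0r !addr0.
  - move=> _ _ [l [m [n [hl hm hn ->]]]] [l' [m' [n' [hl' hm' hn' ->]]]].
    exists (l - l'), (m - m'), (n - n'); split; try exact: vgeB.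
    by rewrite !opprD addrACA [X in X + _]addrACA !scalerBl.
  - move=> r _ hr [l [m [n [hl hm hn ->]]]].
    exists (r * l), (r * m), (r * n); split; try exact: vgeMl.
    by rewrite !scalerDr !scalerA.
move=> w; rewrite /= !inE => /or3P [] /eqP ->.
- by exists 1, 0, 0; rewrite vge_1 // vge_0 // !scale0r scale1r !addr0.
- by exists 0, 1, 0; rewrite vge_1 // vge_0 // !scale0r scale1r add0r addr0.
- by exists 0, 0, 1; rewrite vge_1 // vge_0 // !scale0r scale1r !add0r.
Qed.

Lemma vge_piX n : vge v 0 (pi ^+ n).
Proof. by rewrite (vgeE _ (val_expn hv hpi n)). Qed.

Lemma submod_pi_le (M : set E) u (k l : nat) : submodule (scalars E o) M ->
  (k <= l)%N -> M (pi ^+ k *: u) -> M (pi ^+ l *: u).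
Proof.
move=> hM kl hu; rewrite -(subnK kl) exprD -scalerA.
by apply: (submodZ hM _ hu); apply: vge_piX.
Qed.

(** A scalar of F becomes integral after multiplication by a power of pi, so the F-span is reached
    by clearing denominators with powers of pi alone. *)
Lemma spansP (M : set E) : submodule (scalars E o) M ->
  (spans M <-> forall u, exists k : nat, M (pi ^+ k *: u)).
Proof.
move=> hM; split=> [hs u|hs]; last first.
  apply/seteqP; split=> // u _; have [k hk] := hs u.
  have -> : u = (pi ^+ k)^-1 *: (pi ^+ k *: u).
    by rewrite scalerA mulVf ?scale1r // expf_neq0 // (unif_neq0 hv hpi).
  apply: (submodZ (generated_submodule _ _) _ _) => //.
  exact: sub_generated.
suff /(_ u) : generated (scalars E [set: F]) M `<=`
    [set u | exists k : nat, M (pi ^+ k *: u)] by rewrite hs; apply.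
apply: generated_sub; last by move=> w hw; exists 0%N; rewrite expr0 scale1r.
apply: submodule_scalarsP.
- by exists 0%N; rewrite scaler0; apply: submod0 hM.
- move=> y z [k hk] [l hl]; exists (k + l)%N; rewrite scalerBr.
  by apply: (submodB hM _ _); [apply: submod_pi_le hk|apply: submod_pi_le hl] => //; lia.
- move=> r w _ [l hl]; have [k hk] := vge_bounded hv r.
  exists (k + l)%N; rewrite scalerA mulrC exprD mulrA -scalerA.
  apply: (submodZ hM _ hl); rewrite /o /valuation_ring /= -/(vge v 0 _).
  by rewrite (vge_mulr hv _ _ (val_expn hv hpi k)) sub0r.
Qed.

(** Finitely many generators have a common denominator pi^k, and the condition on u cuts out an
    A-submodule. The ring A is left free: it is the image of o for orders and the order itself for
    fractional ideals. *)
Lemma fg_bounded (A M B : set E) : submodule (scalars E o) B ->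
  (forall u w, A u -> B w -> B (u * w)) ->
  (forall u, exists k : nat, B (pi ^+ k *: u)) ->
  finitely_generated A M -> exists k : nat, forall u, M u -> B (pi ^+ k *: u).
Proof.
move=> hB hA hs [s ->].
have [k hk] : exists k : nat, forall u, u \in s -> B (pi ^+ k *: u).
  elim: s => [|y s [k hk]]; first by exists 0%N.
  have [l hl] := hs y; exists (k + l)%N => u; rewrite inE => /orP [/eqP->|/hk hu].
    by apply: submod_pi_le hl => //; lia.
  by apply: submod_pi_le hu => //; lia.
exists k => u; apply: (@generated_sub _ _ _ [set u | B (pi ^+ k *: u)]) => //.
apply: submoduleP => /=.
- by rewrite scaler0; apply: submod0 hB.
- by move=> y z hy hz; rewrite scalerBr; apply: (submodB hB _ _).
- by move=> r y hr hy; rewrite scalerAr; apply: hA.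
Qed.

End Lattices.

(** * Ramified quadratic extensions *)

Section RamifiedQuadratic.
Variables (F : fieldType) (v : F -> \bar int) (L : fieldExtType F).
Variables (w : L -> \bar int) (x : L).
Hypotheses (hv : normalized_valuation v) (hquad : \dim {:L} = 2%N).
Hypotheses (hram : ramified v w) (hx : uniformizer w x).
Local Notation inj := (in_alg L).

Lemma ramified_norm : normalized_valuation w.
Proof. by case: hram. Qed.
Let hw := ramified_norm.

(** On nonzero elements of F the values of w are multiples of e > 1, whereas w(x) = 1; so x is not
    in F, and 1 and x form a basis in dimension two. *)
Lemma quadratic_coord (y : L) : exists q r, y = inj q + inj r * x.
Proof.
have [_ [e [e1 he]]] := hram.
have xF : x \notin <<[:: (1 : L)%R]>>%VS.
  apply/negP; rewrite span_seq1 => /vlineP [k hk].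
  have [k0|[m hm]] := val_cases hv k.
    by have := val_neq0 hw hx; rewrite hk k0 scale0r eqxx.
  have := he k; rewrite -hk hx hm -EFinM => -[].
  by have [m0|m0] : m <= 0 \/ 1 <= m; [lia| |]; nia.
have hb : basis_of {:L} [:: x; 1].
  rewrite basisEfree free_cons xF subvf hquad leqnn !andbT /=.
  by rewrite seq1_free oner_neq0.
have : y \in <<[:: x; (1 : L)%R]>>%VS by rewrite (span_basis hb) memvf.
rewrite span_cons span_seq1 => /memv_addP [_ /vlineP [r ->] [_ /vlineP [q ->] ->]].
by exists q, r; rewrite -mulr_algl addrC.
Qed.

(** Nonzero terms have valuations congruent to 0 and 1 modulo e, hence distinct, and cannot cancel.
    The index is still a parameter because the lemma serves to prove that it is 2. *)
Lemma ramified_vge (e : nat) k q r : (1 < e)%N ->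
  (forall y, w y%:A = (e%:Z%:E * v y)%E) ->
  vge w k (inj q + inj r * x) = vge w k (inj q) && vge w k (inj r * x).
Proof.
move=> e1 he; apply/idP/andP => [h|[]]; last exact: vgeD.
have [q0|[a ha]] := val_cases hv q.
  by move: h; rewrite q0 rmorph0 add0r (vge_0 hw).
have [r0|[b hb]] := val_cases hv r.
  by move: h; rewrite r0 rmorph0 mul0r addr0 (vge_0 hw).
have h1 : w (inj q) = (e%:Z * a)%:E by rewrite in_algE he ha.
have h2 : w (inj r * x) = (e%:Z * b + 1)%:E by rewrite (valuationM hw) in_algE he hb hx.
rewrite (vgeE _ h1) (vgeE _ h2).
have [lt|lt] : (e%:Z * a < e%:Z * b + 1) \/ (e%:Z * b + 1 < e%:Z * a).
  by have [ab|ab] : a <= b \/ b + 1 <= a; [lia|left|right]; nia.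
  have := val_addl hw h1 (z := inj r * x); rewrite (vgeE _ h2) => /(_ ltac:(lia)) h3.
  by move: h; rewrite (vgeE _ h3); lia.
have := val_addl hw h2 (z := inj q); rewrite (vgeE _ h1) => /(_ ltac:(lia)) h3.
by move: h; rewrite addrC (vgeE _ h3); lia.
Qed.

Let index_neq1 (e : nat) (m : int) : (1 < e)%N -> e%:Z * m != 1.
Proof. by have [?|?] : m <= 0 \/ 1 <= m; [lia| |]; nia. Qed.

Let index_eq2 (e : nat) (m : int) : (1 < e)%N -> e%:Z * m = 2 -> 2 = e%:Z.
Proof.
by have [?|[->|?]] : m <= 0 \/ m = 1 \/ 2 <= m; [lia| |lia|]; nia.
Qed.

(** Expand x^2 as q + r x. Its valuation 2 is that of one of the two terms: e v(r) + 1 = 2 is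
    impossible for e > 1, so e v(q) = 2, and e = 2 follows. *)
Lemma ramified_quadratic_index (y : F) : w y%:A = (2%:E * v y)%E.
Proof.
have [_ [e [e1 he]]] := hram.
suff -> : 2%:E = e%:Z%:E :> \bar int by apply: he.
have [q [r hqr]] := quadratic_coord (x * x).
have hxx : w (x * x) = 2%:E by rewrite (valuationM hw) hx.
have : vge w 2 (x * x) by rewrite (vgeE _ hxx).
have : ~~ vge w 3 (x * x) by rewrite (vgeE _ hxx).
rewrite hqr !(ramified_vge _ _ _ e1 he).
have [->|[a ha]] := val_cases hv q; have [->|[b hb]] := val_cases hv r;
  rewrite ?rmorph0 ?mul0r ?(vge_0 hw) //=.
- have h2 : w (inj r * x) = (e%:Z * b + 1)%:E by rewrite (valuationM hw) in_algE he hb hx.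
  by rewrite !(vgeE _ h2); have := index_neq1 b e1; lia.
- have h1 : w (inj q) = (e%:Z * a)%:E by rewrite in_algE he ha.
  by rewrite !(vgeE _ h1) => ? ?; congr _%:E; apply: (index_eq2 e1 (m := a)); lia.
have h2 : w (inj r * x) = (e%:Z * b + 1)%:E by rewrite (valuationM hw) in_algE he hb hx.
have h1 : w (inj q) = (e%:Z * a)%:E by rewrite in_algE he ha.
rewrite !(vgeE _ h1) !(vgeE _ h2) => ? ?; congr _%:E.
by apply: (index_eq2 e1 (m := a)); have := index_neq1 b e1; lia.
Qed.

Lemma val_inj (q : F) m : v q = m%:E -> w (inj q) = (2 * m)%:E.
Proof. by move=> hq; rewrite in_algE ramified_quadratic_index hq. Qed.

(** Of the bounds 2 v(q) >= 2 k and 2 v(r) + 1 >= 2 k the second rounds up to v(r) >= k; for an odd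
    threshold the rounding falls on q instead. *)
Lemma vge_even k q r :
  vge w (2 * k) (inj q + inj r * x) = vge v k q && vge v k r.
Proof.
rewrite (ramified_vge (e := 2)) //; last exact: ramified_quadratic_index.
rewrite (vge_mulr hw _ _ hx).
have [->|[a ha]] := val_cases hv q; have [->|[b hb]] := val_cases hv r;
  rewrite ?rmorph0 ?(vge_0 hv) ?(vge_0 hw) ?(vgeE _ ha) ?(vgeE _ hb)
    ?(vgeE _ (val_inj ha)) ?(vgeE _ (val_inj hb)) //; lia.
Qed.

Lemma vge_odd k q r :
  vge w (2 * k + 1) (inj q + inj r * x) = vge v (k + 1) q && vge v k r.
Proof.
rewrite (ramified_vge (e := 2)) //; last exact: ramified_quadratic_index.
rewrite (vge_mulr hw _ _ hx).
have [->|[a ha]] := val_cases hv q; have [->|[b hb]] := val_cases hv r;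
  rewrite ?rmorph0 ?(vge_0 hv) ?(vge_0 hw) ?(vgeE _ ha) ?(vgeE _ hb)
    ?(vgeE _ (val_inj ha)) ?(vgeE _ (val_inj hb)) //; lia.
Qed.

(** Uniqueness comes from the valuation: a vanishing difference passes every threshold, so both of
    its coordinates do. *)
Lemma coord_inj q r q' r' :
  inj q + inj r * x = inj q' + inj r' * x -> q = q' /\ r = r'.
Proof.
move=> h; suff [hq hr] : q - q' = 0 /\ r - r' = 0.
  by split; apply/eqP; rewrite -subr_eq0 ?hq ?hr.
have e : inj (q - q') + inj (r - r') * x = 0.
  rewrite !rmorphB mulrBl; transitivity (inj q + inj r * x - (inj q' + inj r' * x)).
    by ring.
  by rewrite h subrr.
by split; apply: (vge_all hv) => k; have := vge_even k%:Z (q - q') (r - r');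
  rewrite e (vge_0 hw) => /esym /andP [].
Qed.

(** The minimal polynomial of x is Eisenstein, with t the trace and n the norm: x^2 passes the
    threshold 2, which bounds both coordinates, and fails 3, which pins v(n) to 1. *)
Lemma eisenstein :
  exists t n, [/\ x * x = inj t * x - inj n, vge v 1 t & v n = 1%:E].
Proof.
have [q [r hqr]] := quadratic_coord (x * x).
have hxx : w (x * x) = 2%:E by rewrite (valuationM hw) hx.
have := vge_even 1 q r; have := vge_odd 1 q r.
rewrite -hqr !(vgeE _ hxx) /= => /esym h /esym /andP [hq hr].
exists r, (- q); split=> //; first by rewrite hqr -!in_algE; ring.
by rewrite (valuationN hv); apply: val_eq => //; move: h; rewrite hr andbT => ->.
Qed.

End RamifiedQuadratic.

(** * The modules O_{a,b,c} *)

Section Modules.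
Variables (F : fieldType) (v : F -> \bar int) (pi : F) (L : fieldExtType F).
Variables (w : L -> \bar int) (x : L) (t n : F).
Hypotheses (hv : normalized_valuation v) (hpi : uniformizer v pi).
Hypotheses (hquad : \dim {:L} = 2%N) (hram : ramified v w).
Hypotheses (hx : uniformizer w x) (hxx : x * x = in_alg L t * x - in_alg L n).
Hypotheses (ht : vge v 1 t) (hn : v n = 1%:E).
Local Notation inj := (in_alg L).
Local Notation E := (prod_alg F L).
Local Notation o := (valuation_ring v).
Local Notation O := (Oabc v pi x).
Local Notation OE := (max_order v w).
Let hw := ramified_norm hram.
Let hpi0 : pi != 0 := unif_neq0 hv hpi.
Let hpiX0 a : pi ^+ a != 0 := expf_neq0 a hpi0.
Let hpiX := val_expn hv hpi.

(** * Coordinates on E and membership in the modules *)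

Definition elt (p q r : F) : E := (p, inj q + inj r * x).

Lemma elt_surj u : exists p q r, u = elt p q r.
Proof.
case: u => p y; have [q [r ->]] := quadratic_coord hv hquad hram hx y.
by exists p, q, r.
Qed.

Lemma elt_inj p q r p' q' r' :
  elt p q r = elt p' q' r' -> [/\ p = p', q = q' & r = r'].
Proof. by case=> -> /(coord_inj hv hquad hram hx) [-> ->]. Qed.

Lemma elt0 : 0 = elt 0 0 0.
Proof. by rewrite /elt !rmorph0 mul0r addr0. Qed.

Lemma elt1 : 1 = elt 1 1 0.
Proof. by rewrite /elt rmorph1 rmorph0 mul0r addr0. Qed.

Lemma elt_sub p q r p' q' r' :
  elt p q r - elt p' q' r' = elt (p - p') (q - q') (r - r').
Proof.
congr pair; change ((inj q + inj r * x) - (inj q' + inj r' * x) =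
  inj (q - q') + inj (r - r') * x).
by ring.
Qed.

Lemma elt_add p q r p' q' r' :
  elt p q r + elt p' q' r' = elt (p + p') (q + q') (r + r').
Proof.
congr pair; change ((inj q + inj r * x) + (inj q' + inj r' * x) =
  inj (q + q') + inj (r + r') * x).
by ring.
Qed.

Lemma elt_scale k p q r : k *: elt p q r = elt (k * p) (k * q) (k * r).
Proof.
congr pair; change (k *: (inj q + inj r * x) = inj (k * q) + inj (k * r) * x).
by rewrite -mulr_algl -in_algE; ring.
Qed.

Lemma elt_mul p q r p' q' r' : elt p q r * elt p' q' r' =
  elt (p * p') (q * q' - r * r' * n) (q * r' + r * q' + r * r' * t).
Proof.
congr pair; change ((inj q + inj r * x) * (inj q' + inj r' * x) =
  inj (q * q' - r * r' * n) + inj (q * r' + r * q' + r * r' * t) * x).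
transitivity (inj q * inj q' + (inj q * inj r' + inj r * inj q') * x +
   inj r * inj r' * (x * x)); first by ring.
by rewrite hxx; ring.
Qed.

Lemma mem_OE p q r : OE (elt p q r) <-> [/\ vge v 0 p, vge v 0 q & vge v 0 r].
Proof.
have := vge_even hv hquad hram hx 0 q r; rewrite mulr0 => h.
change (vge v 0 p /\ vge w 0 (inj q + inj r * x) <->
  [/\ vge v 0 p, vge v 0 q & vge v 0 r]).
by rewrite h; split=> [[hp /andP []]|[-> -> ->]].
Qed.

Lemma Oabc_gen a b c u : O a b c u <->
  exists l m k, [/\ vge v 0 l, vge v 0 m, vge v 0 k &
    u = elt l (l + m * pi ^+ a + k * c) (k * pi ^+ b)].
Proof.
have e l m k : l *: ((1, 1) : E) + m *: ((0, (pi ^+ a)%:A) : E) +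
    k *: ((0, pi ^+ b *: x + c%:A) : E) =
    elt l (l + m * pi ^+ a + k * c) (k * pi ^+ b).
  have -> : ((1, 1) : E) = elt 1 1 0 by rewrite -elt1.
  have -> : ((0, (pi ^+ a)%:A) : E) = elt 0 (pi ^+ a) 0.
    by rewrite /elt rmorph0 mul0r addr0.
  have -> : ((0, pi ^+ b *: x + c%:A) : E) = elt 0 c (pi ^+ b).
    by rewrite /elt !in_algE mulr_algl addrC.
  by rewrite !elt_scale !elt_add; congr elt; ring.
have h : O a b c u <-> exists l m k, [/\ vge v 0 l, vge v 0 m, vge v 0 k &
    u = l *: ((1, 1) : E) + m *: ((0, (pi ^+ a)%:A) : E) +
        k *: ((0, pi ^+ b *: x + c%:A) : E)] by exact: (generated3P hv).
split=> [/h|] [l [m [k [hl hm hk eu]]]].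
  by exists l, m, k; split=> //; rewrite eu e.
by apply/h; exists l, m, k; split=> //; rewrite e.
Qed.

(** The generators are triangular in these coordinates, so the coefficients are forced: p for (1,1),
    then r pi^-b for the third generator, and what is left of q divided by pi^a. *)
Lemma mem_Oabc a b c p q r : O a b c (elt p q r) <->
  [/\ vge v 0 p, vge v b r & vge v a (q - p - r / pi ^+ b * c)].
Proof.
split=> [/Oabc_gen [l [m [k [hl hm hk /elt_inj [-> -> ->]]]]]|[hp hr hq]].
  split=> //; first by rewrite (vge_mulr hv _ _ (hpiX b)) subrr.
  suff -> : l + m * pi ^+ a + k * c - l - k * pi ^+ b / pi ^+ b * c = m * pi ^+ a.
    by rewrite (vge_mulr hv _ _ (hpiX a)) subrr.
  by rewrite mulfK //; ring.
apply/Oabc_gen; exists p, ((q - p - r / pi ^+ b * c) / pi ^+ a), (r / pi ^+ b).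
split=> //.
- by rewrite (vge_mulr hv _ _ (valuationV hv (hpiX a))) opprK add0r.
- by rewrite (vge_mulr hv _ _ (valuationV hv (hpiX b))) opprK add0r.
by rewrite !divfK //; congr elt; ring.
Qed.

Lemma Oabc_submodule a b c : submodule (scalars E o) (O a b c).
Proof. exact: generated_submodule. Qed.

Lemma Oabc_1 a b c : O a b c 1.
Proof.
rewrite elt1; apply/mem_Oabc; rewrite subrr !mul0r subrr !(vge_0 hv).
by rewrite (vge_1 hv).
Qed.

Lemma Oabc_sub_OE a b c : o c -> O a b c `<=` OE.
Proof.
move=> hc u /Oabc_gen [l [m [k [hl hm hk ->]]]]; apply/mem_OE.
split=> //; last by apply: (vgeMl hv) => //; apply: (vge_piX hv hpi).
apply: (vgeD hv); last by apply: (vgeMl hv).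
by apply: (vgeD hv) => //; apply: (vgeMl hv) => //; apply: (vge_piX hv hpi).
Qed.

Lemma Oabc_spans a b c : spans (O a b c).
Proof.
apply/(spansP hv hpi (Oabc_submodule _ _ _)) => u.
have [p [q [r ->]]] := elt_surj u.
have [k1 h1] := vge_bounded hv p; have [k2 h2] := vge_bounded hv r.
have [k3 h3] := vge_bounded hv (q - p - r / pi ^+ b * c).
(* The exponents k1, k2, k3 make the three quantities integral; a and b lift them to the required
   thresholds. *)
exists (k1 + k2 + k3 + a + b)%N; rewrite elt_scale; apply/mem_Oabc.
set k := (k1 + _ + _ + _ + _)%N.
have -> : pi ^+ k * q - pi ^+ k * p - pi ^+ k * r / pi ^+ b * c =
  pi ^+ k * (q - p - r / pi ^+ b * c) by ring.
rewrite !(vge_mull hv _ _ (hpiX k)).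
by split; [apply: vge_le h1 _ | apply: vge_le h2 _ | apply: vge_le h3 _]; lia.
Qed.

Lemma Oabc_fg a b c : finitely_generated (scalars E o) (O a b c).
Proof. by exists [:: (1, 1); (0, (pi ^+ a)%:A); (0, pi ^+ b *: x + c%:A)]. Qed.

(** The generator (1,1) is common to both modules, so the other two decide. As a statement on
    modules it also compares the members of a chain. *)
Lemma Oabc_sub a b c a' b' c' : o c ->
  O a b c `<=` O a' b' c' <->
  [/\ (a' <= a)%N, (b' <= b)%N & vge v a' (c - pi ^+ b / pi ^+ b' * c')].
Proof.
move=> hc; split=> [h|[ha hb hc'] u].
  have /h /mem_Oabc [_ _ h1] : O a b c (elt 0 (pi ^+ a) 0).
    by apply/mem_Oabc; rewrite !mul0r !subr0 !(vge_0 hv) (vgeE _ (hpiX a)).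
  have /h /mem_Oabc [_ h2 h3] : O a b c (elt 0 c (pi ^+ b)).
    apply/mem_Oabc; rewrite subr0 divff // mul1r subrr !(vge_0 hv).
    by rewrite (vgeE _ (hpiX b)).
  move: h1 h2 h3; rewrite !mul0r !subr0 !(vgeE _ (hpiX _)) => h1 h2 h3.
  by split=> //; lia.
have [p [q [r ->]]] := elt_surj u => /mem_Oabc [hp hr hq].
apply/mem_Oabc; split=> //; first by apply: vge_le hr _; lia.
have -> : q - p - r / pi ^+ b' * c' = (q - p - r / pi ^+ b * c) +
   r / pi ^+ b * (c - pi ^+ b / pi ^+ b' * c').
  by field; rewrite !hpiX0.
apply: (vgeD hv); first by apply: vge_le hq _; lia.
apply: (vgeMl hv) => //.
by rewrite (vge_mulr hv _ _ (valuationV hv (hpiX b))) opprK add0r.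
Qed.

Lemma Oabc_eq a b c a' b' c' : o c -> o c' ->
  O a b c = O a' b' c' <-> [/\ a = a', b = b' & vge v a (c - c')].
Proof.
move=> hc hc'; split=> [h|[<- <- h]].
  have /(Oabc_sub _ _ _ _ _ hc) [h1 h2 h3] : O a b c `<=` O a' b' c' by rewrite h.
  have /(Oabc_sub _ _ _ _ _ hc') [h1' h2' _] : O a' b' c' `<=` O a b c by rewrite h.
  have ea : a = a' by lia.
  have eb : b = b' by lia.
  by split=> //; move: h3; rewrite ea eb divff // mul1r.
apply/seteqP; split; apply/Oabc_sub => //; rewrite divff // mul1r //.
by rewrite (vgeBC hv).
Qed.

(** * The norm and the ring criterion *)

(* The norm of pi^b x + c from E' to F. *)
Definition gen_norm b c : F := c ^+ 2 + pi ^+ b * c * t + (pi ^+ b) ^+ 2 * n.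

(** The terms c^2 and pi^(2b) n have valuations of opposite parity, and the mixed term has valuation
    at least b + v(c) + 1, above their minimum. *)
Lemma norm_vge (k : int) b c : vge v k (gen_norm b c) =
  (k <= (2 * b + 1)%N%:Z) && (k%:E <= 2%:E * v c)%E.
Proof.
rewrite /gen_norm; have hnb : v ((pi ^+ b) ^+ 2 * n) = (2 * b + 1)%N%:Z%:E.
  by rewrite (valuationM hv) (valuationXn hv _ (hpiX b)) hn -EFinD; congr _%:E; lia.
have [->|[m hm]] := val_cases hv c.
  rewrite expr0n mulr0 mul0r !add0r (vgeE _ hnb) (valuation0 hv).
  by rewrite gt0_muley ?leey ?andbT // lte_fin.
have hcc : v (c ^+ 2) = (2 * m)%:E by rewrite (valuationXn hv _ hm) mulrC.
have hct : vge v (b%:Z + m + 1) (pi ^+ b * c * t).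
  by apply: (vgeM hv) => //; apply: (vgeM hv);
    rewrite ?(vgeE _ (hpiX b)) ?(vgeE _ hm).
have [le|lt] : m <= b%:Z \/ b%:Z + 1 <= m by lia.
  rewrite -addrA.
  have h : v (c ^+ 2 + (pi ^+ b * c * t + (pi ^+ b) ^+ 2 * n)) = (2 * m)%:E.
    apply: (val_addl hv) => //; apply: (vgeD hv); first by apply: vge_le hct _; lia.
    by rewrite (vgeE _ hnb); lia.
  by rewrite (vgeE _ h) hm -EFinM lee_fin; lia.
rewrite addrC; have h : v ((pi ^+ b) ^+ 2 * n + (c ^+ 2 + pi ^+ b * c * t)) =
    (2 * b + 1)%N%:Z%:E.
  apply: (val_addl hv) => //; apply: (vgeD hv); last by apply: vge_le hct _; lia.
  by rewrite (vgeE _ hcc); lia.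
by rewrite (vgeE _ h) hm -EFinM lee_fin; lia.
Qed.

Lemma vge_uphalf (a : nat) c : vge v (uphalf a) c = (a%:Z%:E <= 2%:E * v c)%E.
Proof.
have [->|[m hm]] := val_cases hv c.
  by rewrite (vge_0 hv) (valuation0 hv) gt0_muley ?leey // lte_fin.
by rewrite (vgeE _ hm) hm -EFinM lee_fin; lia.
Qed.

Lemma mem_Oabc_mul a b c u u' : o c -> vge v (Posz a) (gen_norm b c) ->
  O a b c u -> O a b c u' -> O a b c (u * u').
Proof.
move=> hc hN /Oabc_gen [l [m [k [hl hm hk ->]]]].
move=> /Oabc_gen [l' [m' [k' [hl' hm' hk' ->]]]]; rewrite elt_mul.
(* With g = pi^b x + c, T = 2 c + pi^b t and N = [gen_norm b c], one has g^2 = T g - N. The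
   coefficients collect the product, with N written as N pi^-a times pi^a. *)
apply/Oabc_gen; exists (l * l'),
  (l * m' + m * l' + m * m' * pi ^+ a - k * k' * (gen_norm b c / pi ^+ a)),
  (l * k' + k * l' + (m * k' + k * m') * pi ^+ a +
   k * k' * (pi ^+ b * t + (c + c))).
have hX := vge_piX hv hpi.
have ht0 : vge v 0 t by apply: vge_le ht _.
have hNa : vge v 0 (gen_norm b c / pi ^+ a).
  by rewrite (vge_mulr hv _ _ (valuationV hv (hpiX a))) opprK add0r.
split.
- exact: (vgeMl hv).
- by repeat (done || apply: (vgeB hv) || apply: (vgeD hv) || apply: (vgeMl hv)).
- by repeat (done || apply: (vgeD hv) || apply: (vgeMl hv)).
congr elt; rewrite /gen_norm; last by ring.
by field; rewrite hpiX0.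
Qed.

Lemma Oabc_orderP a b c : o c ->
  is_order v (O a b c) <-> vge v a (gen_norm b c).
Proof.
move=> hc; split=> [[[_ _ h] _ _ _]|hN].
  (* The decisive test is the square of the generator (0, pi^b x + c): the linear form that pi^a
     must divide takes the value minus the norm on it. *)
  have hg : O a b c (elt 0 c (pi ^+ b)).
    by apply/Oabc_gen; exists 0, 0, 1; rewrite !(vge_0 hv) (vge_1 hv);
      split=> //; congr elt; ring.
  have := h _ _ (mem_set hg) (mem_set hg); rewrite inE elt_mul => /mem_Oabc [_ _].
  suff -> : c * c - pi ^+ b * pi ^+ b * n - 0 * 0 -
     (c * pi ^+ b + pi ^+ b * c + pi ^+ b * pi ^+ b * t) / pi ^+ b * c = - gen_norm b c.
    by rewrite (vgeN hv).
  by rewrite /gen_norm; field; rewrite hpiX0.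
split; [split| |exact: Oabc_fg|exact: Oabc_spans].
- by rewrite inE; apply: Oabc_1.
- by move=> u u'; rewrite !inE; apply: submodB; apply: Oabc_submodule.
- by move=> u u'; rewrite !inE; apply: mem_Oabc_mul.
move=> _ [k hk <-]; apply: (submodZ (Oabc_submodule _ _ _)) => //; exact: Oabc_1.
Qed.

Lemma order_criterion a b c :
  (a%:Z%:E <= Order.min (2 * b + 1)%N%:Z%:E (2%:E * v c))%E = vge v a (gen_norm b c).
Proof. by rewrite le_min norm_vge lee_fin. Qed.

(** * Lattices in the maximal order and their normal form *)

Lemma OE_mul u u' : OE u -> OE u' -> OE (u * u').
Proof.
by move=> [hu1 hu2] [hu1' hu2']; split; [apply: (vgeMl hv)|apply: (vgeMl hw)].
Qed.

Lemma OE_submodule : submodule (scalars E o) OE.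
Proof.
apply: submodule_scalarsP.
- by rewrite elt0; apply/mem_OE; rewrite (vge_0 hv).
- by move=> u u' [hu1 hu2] [hu1' hu2']; split; [apply: (vgeB hv)|apply: (vgeB hw)].
move=> k u hk; have [p [q [r ->]]] := elt_surj u.
move=> /mem_OE [hp hq hr]; rewrite elt_scale; apply/mem_OE.
by split; apply: (vgeMl hv).
Qed.

Lemma OE_spans u : exists k : nat, OE (pi ^+ k *: u).
Proof.
have [p [q [r ->]]] := elt_surj u.
have [k1 h1] := vge_bounded hv p; have [k2 h2] := vge_bounded hv q.
have [k3 h3] := vge_bounded hv r; exists (k1 + k2 + k3)%N; rewrite elt_scale.
apply/mem_OE; rewrite !(vge_mull hv _ _ (hpiX _)).
by split; [apply: vge_le h1 _ | apply: vge_le h2 _ | apply: vge_le h3 _]; lia.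
Qed.

Lemma vge_piX_scale (j : int) k y : vge w j (pi ^+ k *: y) = vge w (j - 2 * k%:Z) y.
Proof.
rewrite -mulr_algl (vge_mull hw _ _ (k := 2 * k%:Z)) //.
by rewrite (ramified_quadratic_index hv hquad hram hx) hpiX.
Qed.

Lemma fg_bounded_OE (A M : set E) : A `<=` OE -> finitely_generated A M ->
  exists k : nat, forall u, M u ->
    vge v (- k%:Z) u.1 /\ vge w (- (2 * k%:Z)) u.2.
Proof.
move=> hA hM; have [|k hk] := fg_bounded hv hpi OE_submodule _ OE_spans hM.
  by move=> u u' /hA; apply: OE_mul.
exists k => u /hk [h1 h2]; rewrite -(sub0r k%:Z) -(sub0r (2 * k%:Z)).
by rewrite -(vge_mull hv _ _ (hpiX k)) -vge_piX_scale.
Qed.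

(** All powers of an element stay in the order, which has bounded denominators as a finitely
    generated module; so neither component has negative valuation. *)
Lemma order_sub_OE R : is_order v R -> R `<=` OE.
Proof.
move=> [[h1 hB hM] hoR hfg _] u hu.
have hX i : R (u ^+ i).
  elim: i => [|i IH]; first by rewrite expr0; move: h1; rewrite inE.
  by rewrite exprS; have := hM u (u ^+ i); rewrite !inE; apply.
have e i : u ^+ i = (u.1 ^+ i, u.2 ^+ i).
  by elim: i => [|i IH]; rewrite ?expr0 // !exprS IH.
have [|k hk] := fg_bounded_OE _ hfg.
  move=> _ [r hr <-]; apply: (submodZ OE_submodule) => //.
  by rewrite elt1; apply/mem_OE; rewrite (vge_0 hv) (vge_1 hv).
split.
  by apply: (vge_powers hv (k := k%:Z)) => i; have [] := hk _ (hX i); rewrite e.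
by apply: (vge_powers hw (k := 2 * k%:Z)) => i; have [] := hk _ (hX i); rewrite e.
Qed.

(** A Hermite normal form: a and b are the least exponents such that M contains (0, pi^a),
    respectively some (0, c + pi^b x). As 1 is in M, the coordinate p of any element can be cleared;
    then r and what is left of q are reduced in turn. *)
Lemma normal_form M : submodule (scalars E o) M -> M 1 -> M `<=` OE -> spans M ->
  exists a b c, o c /\ M = O a b c.
Proof.
move=> hM h1 hMO /(spansP hv hpi hM) hs.
have [a /asboolP ha mina] : exists2 a, `[< M (elt 0 (pi ^+ a) 0) >] &
    forall k, M (elt 0 (pi ^+ k) 0) -> (a <= k)%N.
  have [k hk] := hs (elt 0 1 0).
  have h : exists k, `[< M (elt 0 (pi ^+ k) 0) >].
    by exists k; apply/asboolP; move: hk; rewrite elt_scale mulr1 !mulr0.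
  by exists (ex_minn h); case: ex_minnP => // a _ ha l hl; apply: ha; apply/asboolP.
have [b /asboolP [c hc] minb] : exists2 b, `[< exists q, M (elt 0 q (pi ^+ b)) >] &
    forall k, (exists q, M (elt 0 q (pi ^+ k))) -> (b <= k)%N.
  have [k hk] := hs (elt 0 0 1).
  have h : exists k, `[< exists q, M (elt 0 q (pi ^+ k)) >].
    by exists k; apply/asboolP; exists 0; move: hk; rewrite elt_scale mulr1 !mulr0.
  by exists (ex_minn h); case: ex_minnP => // b _ hb l hl; apply: hb; apply/asboolP.
have oc : o c by have /mem_OE [] := hMO _ hc.
exists a, b, c; split=> //; apply/seteqP; split=> u; last first.
  move=> /Oabc_gen [l [m [k [hl hm hk ->]]]].
  have -> : elt l (l + m * pi ^+ a + k * c) (k * pi ^+ b) =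
     l *: 1 + (m *: elt 0 (pi ^+ a) 0 + k *: elt 0 c (pi ^+ b)).
    by rewrite elt1 !elt_scale !elt_add; congr elt; ring.
  by apply: (submodD hM); [|apply: (submodD hM)]; apply: (submodZ hM).
have [p [q [r ->]]] := elt_surj u => hu; have /mem_OE [hp hq hr] := hMO _ hu.
have hu1 : M (elt 0 (q - p) r).
  have -> : elt 0 (q - p) r = elt p q r - p *: 1.
    by rewrite elt1 elt_scale elt_sub; congr elt; ring.
  by apply: (submodB hM) => //; apply: (submodZ hM).
(* Multiplying by pi^k / y, a unit of o, turns a coordinate y of valuation k into pi^k itself, to
   which the minimality of a or b applies. *)
have scaled (q' r' y : F) (k : nat) : v y = k%:Z%:E -> M (elt 0 q' r') ->
    M (elt 0 (pi ^+ k / y * q') (pi ^+ k / y * r')).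
  move=> hy h; rewrite -[X in elt X _ _](mulr0 (pi ^+ k / y)) -elt_scale.
  apply: (submodZ hM) => //; change (vge v 0 (pi ^+ k / y)).
  by rewrite (vge_mulr hv _ _ (valuationV hv hy)) (vgeE _ (hpiX k)); lia.
have hbr : vge v b r.
  have [->|[j hj]] := val_cases hv r; first exact: vge_0.
  move: hr; rewrite !(vgeE _ hj); case: j hj => // k hj _.
  have := scaled _ _ _ _ hj hu1; rewrite divfK; last exact: val_neq0 hj.
  by move=> h; have := minb k (ex_intro _ _ h).
apply/mem_Oabc; split=> //; set s := r / pi ^+ b.
have os : vge v 0 s.
  by rewrite (vge_mulr hv _ _ (valuationV hv (hpiX b))) opprK add0r.
have hu2 : M (elt 0 (q - p - s * c) 0).
  have -> : elt 0 (q - p - s * c) 0 = elt 0 (q - p) r - s *: elt 0 c (pi ^+ b).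
    by rewrite elt_scale elt_sub divfK //; congr elt; ring.
  by apply: (submodB hM) => //; apply: (submodZ hM).
have /mem_OE [_ hz _] := hMO _ hu2.
have [->|[j hj]] := val_cases hv (q - p - s * c); first exact: vge_0.
move: hz; rewrite !(vgeE _ hj); case: j hj => // k hj _.
have := scaled _ _ _ _ hj hu2; rewrite divfK ?mulr0; last exact: val_neq0 hj.
by move=> /mina.
Qed.

Lemma order_submodule (R : set E) : is_order v R -> submodule (scalars E o) R.
Proof.
move=> [[h1 hB hM] hoR _ _]; apply: submoduleP.
- by have := hB _ _ h1 h1; rewrite subrr inE.
- by move=> u u' hu hu'; have := hB u u'; rewrite !inE; apply.
- by move=> r u /hoR hr hu; have := hM r u; rewrite !inE; apply.
Qed.

Lemma order_form R : is_order v R -> exists a b c,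
  [/\ o c, (a%:Z%:E <= Order.min (2 * b + 1)%N%:Z%:E (2%:E * v c))%E & R = O a b c].
Proof.
move=> hR; have [[h1 _ _] _ _ hs] := hR.
have [|a [b [c [hc e]]]] := normal_form (order_submodule hR) _ (order_sub_OE hR) hs.
  by move: h1; rewrite inE.
exists a, b, c; split=> //; rewrite order_criterion.
by apply/Oabc_orderP => //; rewrite -e.
Qed.

(** * Inclusions between orders *)

Lemma piX_div b b' : pi ^+ b / pi ^+ b' = pi ^ (b%:Z - b'%:Z).
Proof. by rewrite expfzDr // -exprnN. Qed.

Lemma vge_shift (k d : int) c c' :
  vge v k (c - pi ^ d * c') = vge v (k - d) (c' - pi ^ (- d) * c).
Proof.
have -> : c - pi ^ d * c' = - (pi ^ d * (c' - pi ^ (- d) * c)).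
  by rewrite mulrBr mulrA -expfzDr // subrr expr0z mul1r opprB.
by rewrite (vgeN hv) (vge_mull hv _ _ (val_expz hv hpi d)).
Qed.

Lemma order_vge_uphalf a b c : o c -> is_order v (O a b c) -> vge v (uphalf a) c.
Proof.
by move=> hc /(Oabc_orderP _ _ hc); rewrite norm_vge vge_uphalf => /andP [].
Qed.

(** Both cases restate v(c - pi^d c') >= a' with d = b - b', after division by pi^d. If v(c) >= a',
    the term in c is absorbed, and the bound by [uphalf a'] in the maximum is supplied by the order
    [O a' b' c']. *)
Lemma order_sub a b a' b' c c' : o c -> o c' -> is_order v (O a' b' c') ->
  O a b c `<=` O a' b' c' <->
  [/\ (a' <= a)%N, (b' <= b)%N &
     if (a'%:Z%:E <= v c)%E
     then vge v (Order.max (uphalf a')%:Z (a'%:Z - (b%:Z - b'%:Z))) c'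
     else vge v (a'%:Z - (b%:Z - b'%:Z)) (c' - pi ^ (- (b%:Z - b'%:Z)) * c)].
Proof.
move=> hc hc' /(order_vge_uphalf hc') h.
suff e : (if (a'%:Z%:E <= v c)%E
     then vge v (Order.max (uphalf a')%:Z (a'%:Z - (b%:Z - b'%:Z))) c'
     else vge v (a'%:Z - (b%:Z - b'%:Z)) (c' - pi ^ (- (b%:Z - b'%:Z)) * c)) =
    vge v a' (c - pi ^+ b / pi ^+ b' * c').
  by rewrite Oabc_sub // e.
rewrite piX_div (vge_shift _ _ c) -/(vge v a' c); case: ifP => // ha.
rewrite vge_max h /= (vge_addr hv) // (vgeN hv) (vge_mull hv _ _ (val_expz hv hpi _)) opprK.
by apply: vge_le ha _; lia.
Qed.

(** With d = b - b', c' agrees with pi^-d c modulo pi^(a'-d), and v(pi^-d c) = v(c) - d lies below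
    a' - d, so c' has that valuation. It is at least [uphalf a'] >= 0, whence d <= v(c) < a'. *)
Lemma order_sub_val a b a' b' c c' : o c -> o c' -> is_order v (O a' b' c') ->
  O a b c `<=` O a' b' c' -> (v c < a'%:Z%:E)%E ->
  [/\ ((uphalf a')%:Z%:E <= v c - (b%:Z - b'%:Z)%:E)%E,
      (v c - (b%:Z - b'%:Z)%:E)%E = v c' &
      0 < a'%:Z - (b%:Z - b'%:Z)].
Proof.
move=> hc hc' /(order_vge_uphalf hc') h /(Oabc_sub _ _ _ _ _ hc) [_ _].
rewrite piX_div vge_shift; set d := b%:Z - b'%:Z.
have [->|[m hm]] := val_cases hv c; first by rewrite (valuation0 hv) ltNge leey.
rewrite hm lte_fin => h1 hma.
have h2 : v (pi ^ (- d) * c) = (m - d)%:E.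
  by rewrite (valuationM hv) (val_expz hv hpi) hm -EFinD addrC.
have hc'm : v c' = (m - d)%:E.
  rewrite -[c'](subrKC (pi ^ (- d) * c)); apply: (val_addl hv) => //.
  by apply: vge_le h1 _; lia.
rewrite hc'm -EFinB; split=> //; first by move: h; rewrite (vgeE _ hc'm).
by move: h; rewrite (vgeE _ hc'm); lia.
Qed.

(** * The length of the maximal order modulo a module *)

Lemma between_form M a b c : submodule (scalars E o) M ->
  O a b c `<=` M -> M `<=` OE -> exists a' b' c', o c' /\ M = O a' b' c'.
Proof.
move=> hM hOM hMO; apply: (normal_form hM) => //; first by apply: hOM; apply: Oabc_1.
apply/(spansP hv hpi hM) => u.
have /(spansP hv hpi (Oabc_submodule _ _ _)) /(_ u) [k hk] := Oabc_spans a b c.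
by exists k; apply: hOM.
Qed.

Lemma OE_Oabc : OE = O 0 0 0.
Proof.
apply/seteqP; split=> u; have [p [q [r ->]]] := elt_surj u.
  move=> /mem_OE [hp hq hr]; apply/mem_Oabc.
  by rewrite mulr0 subr0; split=> //; apply: (vgeB hv).
move=> /mem_Oabc; rewrite mulr0 subr0 => -[hp hr hq]; apply/mem_OE; split=> //.
by rewrite -[q](subrK p); apply: (vgeD hv).
Qed.

Lemma Oabc_length a b c : o c ->
  quotient_length (scalars E o) OE (O a b c) (a + b).
Proof.
move=> hc; split.
  (* The exponent a is lowered to 0 before b: with truncated subtraction, i - a stays 0 until i
     passes a. In the second phase the first exponent is 0, and the congruence on c only asks for
     integrality. *)
  exists (fun i => O (a - i) (b - (i - a)) c); split.
  - by rewrite subn0 sub0n subn0.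
  - have -> : (a - (a + b) = 0)%N by lia.
    have -> : (b - (a + b - a) = 0)%N by lia.
    rewrite OE_Oabc; apply/Oabc_eq => //; first exact: (vge_0 hv).
    by rewrite subr0.
  - by move=> i _; apply: Oabc_submodule.
  move=> i hi; split.
    apply/Oabc_sub => //; split; [lia|lia|].
    have -> : c - pi ^+ (b - (i - a)) / pi ^+ (b - (i.+1 - a)) * c =
      (1 - pi ^+ (b - (i - a)) / pi ^+ (b - (i.+1 - a))) * c by ring.
    have [ia|ai] := ltnP i a.
      have -> : (i - a = i.+1 - a)%N by lia.
      by rewrite divff // subrr mul0r; apply: vge_0.
    have -> : (a - i.+1 = 0)%N by lia.
    apply: (vgeMl hv) => //; apply: (vgeB hv); first exact: vge_1.
    rewrite piX_div (vgeE _ (val_expz hv hpi _)); lia.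
  move=> /(Oabc_sub _ _ _ _ _ hc) []; lia.
move=> m M [M0 Mm hM hlt].
have sub i j : (i <= j <= m)%N -> M i `<=` M j.
  case/andP; elim: j => [|j IH]; first by rewrite leqn0 => /eqP -> _ u.
  rewrite leq_eqVlt => /orP [/eqP -> _ u //|ij jm].
  exact: subset_trans (IH ij (ltnW jm)) (properW (hlt j jm)).
have {}sub0 i : (i <= m)%N -> O a b c `<=` M i /\ M i `<=` OE.
  by move=> im; rewrite -M0 -Mm; split; apply: sub; rewrite ?leq0n ?im ?leqnn.
(* Each strict step lowers the sum of the two exponents: if both stayed equal, the congruence on c,
   being symmetric, would make the inclusion an equality. *)
suff : forall i, (i <= m)%N -> exists a' b' c', [/\ o c', M i = O a' b' c' &
    (a' + b' + i <= a + b)%N].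
  by move=> /(_ m (leqnn m)) [a' [b' [c' [_ _ h]]]]; lia.
elim=> [|i IH] im; first by exists a, b, c; rewrite addn0.
have [a1 [b1 [c1 [hc1 e1 h1]]]] := IH (ltnW im).
have [hOM hMO] := sub0 _ im.
have [a2 [b2 [c2 [hc2 e2]]]] := between_form (hM _ im) hOM hMO.
exists a2, b2, c2; split=> //; have [] := hlt i im.
rewrite e1 e2 => /(Oabc_sub _ _ _ _ _ hc1) [ha hb hcc] hn'.
suff : a2 != a1 \/ b2 != b1 by lia.
have [ea|] := eqVneq a2 a1; last by left.
have [eb|] := eqVneq b2 b1; last by right.
case: hn'; apply/Oabc_sub => //; move: hcc; rewrite ea eb divff // mul1r.
by rewrite mul1r (vgeBC hv).
Qed.

(** * The conductor *)

(** By linearity it suffices to multiply by the o-basis (1,0), (0,1), (0,x) of the maximal order;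
    the five conditions gather what these products require. *)
Lemma conductor_coord a b c p q r : o c ->
  conductor OE (O a b c) (elt p q r) <->
  [/\ vge v a p, vge v b r, vge v a (q - r / pi ^+ b * c), vge v b (q + r * t) &
      vge v a (r * n + (q + r * t) / pi ^+ b * c)].
Proof.
move=> hc; split=> [[_ h]|[hp hr hq hr' hq']].
  have h1 : OE (elt 1 0 0) by apply/mem_OE; rewrite !(vge_0 hv) (vge_1 hv).
  have h2 : OE (elt 0 1 0) by apply/mem_OE; rewrite !(vge_0 hv) (vge_1 hv).
  have h3 : OE (elt 0 0 1) by apply/mem_OE; rewrite !(vge_0 hv) (vge_1 hv).
  move: (h _ h1) (h _ h2) (h _ h3); rewrite !elt_mul.
  rewrite !(mulr0, mul0r, mulr1, subr0, addr0, add0r, sub0r).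
  move=> /mem_Oabc [_ _]; rewrite oppr0 !(mul0r, subr0, sub0r) (vgeN hv) => ->.
  move=> /mem_Oabc [_ ->]; rewrite subr0 => ->.
  by move=> /mem_Oabc [_ ->]; rewrite subr0 -opprD (vgeN hv).
have hs (b' : nat) y : vge v b' y -> vge v 0 (y / pi ^+ b').
  by rewrite (vge_mulr hv _ _ (valuationV hv (hpiX b'))) opprK add0r.
split.
  apply/mem_OE; split; first by apply: vge_le hp _.
    rewrite -[q](subrK (r / pi ^+ b * c)); apply: (vgeD hv).
      by apply: vge_le hq _.
    by apply: (vgeMl hv) => //; apply: hs.
  by apply: vge_le hr _.
move=> u; have [p' [q' [r' ->]]] := elt_surj u => /mem_OE [op oq or].
rewrite elt_mul; apply/mem_Oabc; split.
- by apply: (vgeMl hv) => //; apply: vge_le hp _.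
- have -> : q * r' + r * q' + r * r' * t = r' * (q + r * t) + q' * r by ring.
  by apply: (vgeD hv); apply: (vgeMl hv).
have -> : q * q' - r * r' * n - p * p' -
    (q * r' + r * q' + r * r' * t) / pi ^+ b * c =
  q' * (q - r / pi ^+ b * c) - r' * (r * n + (q + r * t) / pi ^+ b * c) - p' * p.
  by field; rewrite hpiX0.
by apply: (vgeB hv); [apply: (vgeB hv)|]; apply: (vgeMl hv).
Qed.

(* Writing S = r pi^-b c: if v(S) < a then v(q) = v(S), and the two terms of
   least valuation in the last condition of [conductor_coord] cannot cancel,
   since v(r n) - v(S) = b - v(c) + 1 and v(q pi^-b c) - v(S) = v(c) - b. *)
Lemma conductor_vge a b c p q r : o c ->
  conductor OE (O a b c) (elt p q r) <->
  vge v a p /\ [/\ vge v a q && vge v (a%:Z - 1) r, vge v b q && vge v b r &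
    vge v a (q / pi ^+ b * c) && vge v a (r / pi ^+ b * c)].
Proof.
move=> hc; rewrite conductor_coord //.
have hs (k : int) y : vge v k (y / pi ^+ b) = vge v (k + b%:Z) y.
  by rewrite (vge_mulr hv _ _ (valuationV hv (hpiX b))) opprK.
have ht0 k y : vge v k y -> vge v (k + 1) (y * t) by move=> hy; apply: (vgeM hv).
have hrn k : vge v k (r * n) = vge v (k - 1) r by rewrite (vge_mulr hv _ _ hn).
split=> [[hp hr hq hr' hq']|[hp [/andP [hq hr] /andP [hqb hrb] /andP [hqc hrc]]]]; last first.
  split=> //; first by apply: (vgeB hv).
    by apply: (vgeD hv) => //; apply: vge_le (ht0 _ _ hrb) _; lia.
  apply: (vgeD hv); first by rewrite hrn.
  rewrite !mulrDl; apply: (vgeD hv) => //.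
  have -> : r * t / pi ^+ b * c = (r / pi ^+ b * c) * t by ring.
  by apply: vge_le (ht0 _ _ hrc) _; lia.
split=> //.
have hqb : vge v b q.
  by move: hr'; rewrite (vge_addr hv) //; apply: vge_le (ht0 _ _ hr) _; lia.
have [c0|[m hm]] := val_cases hv c.
  move: hq hq'; rewrite c0 !mulr0 subr0 addr0 hrn => -> ->.
  by rewrite hqb hr !(vge_0 hv).
have hsc (k : int) y : vge v k (y / pi ^+ b * c) = vge v (k - m + b%:Z) y.
  by rewrite (vge_mulr hv _ _ hm) hs.
have hS : vge v a (r / pi ^+ b * c).
  have [S0|[j hj]] := val_cases hv (r / pi ^+ b * c); first by rewrite S0 vge_0.
  rewrite (vgeE _ hj) leNgt; apply/negP => ja.
  have hqj : v q = j%:E.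
    rewrite -[q](subrKC (r / pi ^+ b * c)); apply: (val_addl hv) => //.
    by apply: vge_le hq _; lia.
  have hr1 (k : int) : vge v k r = (k <= j - m + b%:Z).
    have := vgeE (k - b%:Z + m) hj; rewrite hsc.
    have -> : k - b%:Z + m - m + b%:Z = k by lia.
    by move=> ->; lia.
  have e : r * n + (q + r * t) / pi ^+ b * c =
    q / pi ^+ b * c + r * n + (r / pi ^+ b * c) * t by ring.
  have hqc : v (q / pi ^+ b * c) = (j - b%:Z + m)%:E.
    by rewrite !(valuationM hv) hm hqj (valuationV hv (hpiX b)) -!EFinD.
  have hrn1 : v (r * n) = (j - m + b%:Z + 1)%:E.
    by apply: val_eq; rewrite hrn hr1; lia.
  have hSt : vge v (j + 1) (r / pi ^+ b * c * t) by apply: ht0; rewrite (vgeE _ hj).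
  (* Whichever of q pi^-b c and r n is least has valuation at most j < a and lies strictly below the
     other two terms, against [hq']. *)
  move: hq'; rewrite e; have [mb|bm] : m <= b%:Z \/ b%:Z + 1 <= m by lia.
    have h : v (q / pi ^+ b * c + r * n + r / pi ^+ b * c * t) = (j - b%:Z + m)%:E.
      rewrite -addrA; apply: (val_addl hv) => //; apply: (vgeD hv).
        by rewrite (vgeE _ hrn1); lia.
      by apply: vge_le hSt _; lia.
    by rewrite (vgeE _ h); lia.
  have h : v (r * n + (q / pi ^+ b * c + r / pi ^+ b * c * t)) = (j - m + b%:Z + 1)%:E.
    apply: (val_addl hv) => //; apply: (vgeD hv).
      by rewrite (vgeE _ hqc); lia.
    by apply: vge_le hSt _; lia.
  by rewrite addrAC addrC (vgeE _ h); lia.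
have hqa : vge v a q by rewrite -[q](subrK (r / pi ^+ b * c)); apply: (vgeD hv).
have : vge v a (r * n + q / pi ^+ b * c).
  have := hq'; have -> : r * n + (q + r * t) / pi ^+ b * c =
    r * n + q / pi ^+ b * c + (r / pi ^+ b * c) * t by ring.
  by rewrite (vge_addr hv) //; apply: vge_le (ht0 _ _ hS) _; lia.
(* It remains to split a sum of valuation at least a. If v(c) >= b, the bound on q controls q pi^-b
   c; if v(c) < b, the bound on r pi^-b c controls r n. The other term follows. *)
rewrite hqa hqb hr hS andbT /=; have [bm|mb] : b%:Z <= m \/ m + 1 <= b%:Z by lia.
  have hqc : vge v a (q / pi ^+ b * c) by rewrite hsc; apply: vge_le hqa _; lia.
  by rewrite (vge_addr hv) // hrn hqc => ->.
have hr1 : vge v (a%:Z - 1) r by move: hS; rewrite hsc => /vge_le; apply; lia.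
by rewrite (vge_addl hv) ?hrn // hr1 => ->.
Qed.

(** The three pairs of bounds on q and r amount to the thresholds 2 a - 1, 2 b and 2 (a + b - v(c))
    for w, whose maximum is the exponent. *)
Lemma conductor_Oabc a b c : o c ->
  conductor OE (O a b c) = [set p | vge v a p] `*`
    [set y | vge w (fine (Order.max (2 * a)%N%:Z%:E
      (Order.max (2 * b + 1)%N%:Z%:E
         ((2 * a + 2 * b)%N%:Z%:E - 2%:E * v c + 1%:E)) - 1%:E)%E) y].
Proof.
move=> hc; apply/seteqP.
suff h u : conductor OE (O a b c) u <-> ([set p | vge v a p] `*`
    [set y | vge w (fine (Order.max (2 * a)%N%:Z%:E
      (Order.max (2 * b + 1)%N%:Z%:E
         ((2 * a + 2 * b)%N%:Z%:E - 2%:E * v c + 1%:E)) - 1%:E)%E) y]) u.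
  by split=> u /h.
have [p [q [r ->]]] := elt_surj u; rewrite conductor_vge //.
set k := fine _.
change (vge v a p /\ [/\ vge v a q && vge v (a%:Z - 1) r, vge v b q && vge v b r &
    vge v a (q / pi ^+ b * c) && vge v a (r / pi ^+ b * c)] <->
  vge v a p /\ vge w k (inj q + inj r * x)).
have h1 : vge v a q && vge v (a%:Z - 1) r = vge w (2 * a%:Z - 1) (inj q + inj r * x).
  have := vge_odd hv hquad hram hx (a%:Z - 1) q r; rewrite subrK => <-.
  by congr vge; lia.
rewrite -(vge_even hv hquad hram hx b) h1.
have -> : [/\ vge w (2 * a%:Z - 1) (inj q + inj r * x),
   vge w (2 * b%:Z) (inj q + inj r * x)
   & vge v a (q / pi ^+ b * c) && vge v a (r / pi ^+ b * c)] =
   (vge w k (inj q + inj r * x) : Prop); last by [].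
have [c0|[m hm]] := val_cases hv c.
  rewrite c0 !mulr0 !(vge_0 hv) andbT.
  (* For c = 0 the third term of the maximum is -oo and drops out. *)
  have -> : k = Order.max (2 * a%:Z - 1) (2 * b%:Z).
    rewrite /k c0 (valuation0 hv) gt0_muley ?lte_fin //.
    by rewrite addeNy addNye maxeNy -EFin_max -EFinB; cbn [fine]; lia.
  by rewrite vge_max; apply/propext; split=> [[-> ->]|/andP []].
have -> : k = Order.max (2 * a%:Z - 1) (Order.max (2 * b%:Z) (2 * (a%:Z + b%:Z - m))).
  by rewrite /k hm -EFinM -EFinB -EFinD -!EFin_max -EFinB; cbn [fine]; lia.
rewrite !vge_max (vge_even hv hquad hram hx (a%:Z + b%:Z - m)).
have hsc y : vge v a (y / pi ^+ b * c) = vge v (a%:Z + b%:Z - m) y.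
  rewrite (vge_mulr hv _ _ hm) (vge_mulr hv _ _ (valuationV hv (hpiX b))) opprK.
  by congr vge; lia.
by rewrite !hsc; apply/propext; split=> [[-> -> ->]|/and3P []].
Qed.

(** * Gorenstein orders *)

Lemma norm_piX b k c : gen_norm (b + k) (pi ^+ k * c) = (pi ^+ k) ^+ 2 * gen_norm b c.
Proof. by rewrite /gen_norm exprD; ring. Qed.

(** Put g = (0, pi^b x + c) and N = [gen_norm b c]. Since 1 lies in the module, so does any
    multiplier; let s be its coefficient at g. Multiplication by g forces pi^a to divide s N, that
    is v(s) >= k, which replaces g by pi^k g. Conversely pi^k N pi^-a is integral, so such elements
    are multipliers. *)
Lemma multiplier_Oabc a b c (k : nat) : o c ->
  v (gen_norm b c) = (a%:Z - k%:Z)%:E ->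
  multiplier_ring (O a b c) = O a (b + k) (pi ^+ k * c).
Proof.
move=> hc hN; apply/seteqP; split=> u.
  move=> h; have := h 1 (@Oabc_1 a b c); rewrite mulr1.
  move=> /Oabc_gen [l [m [s [hl hm hs e]]]].
  have hg : O a b c (elt 0 c (pi ^+ b)).
    apply/mem_Oabc; rewrite subr0 divff // mul1r subrr !(vge_0 hv).
    by rewrite (vgeE _ (hpiX b)).
  have := h _ hg; rewrite e elt_mul => /mem_Oabc [_ _].
  have -> : (l + m * pi ^+ a + s * c) * c - s * pi ^+ b * pi ^+ b * n - l * 0 -
    ((l + m * pi ^+ a + s * c) * pi ^+ b + s * pi ^+ b * c +
    s * pi ^+ b * pi ^+ b * t) / pi ^+ b * c = - (s * gen_norm b c).
    by rewrite /gen_norm; field; rewrite hpiX0.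
  rewrite (vgeN hv) (vge_mulr hv _ _ hN) => hks; apply/mem_Oabc; split=> //.
    rewrite (vge_mulr hv _ _ (hpiX b)); apply: vge_le hks _; lia.
  have -> : l + m * pi ^+ a + s * c - l - s * pi ^+ b / pi ^+ (b + k) * (pi ^+ k * c) =
    m * pi ^+ a by rewrite exprD; field; rewrite !hpiX0.
  by rewrite (vge_mulr hv _ _ (hpiX a)) subrr.
move=> /Oabc_gen [l [m [s [hl hm hs ->]]]] u' /Oabc_gen [l' [m' [s' [hl' hm' hs' ->]]]].
rewrite elt_mul; apply/Oabc_gen; exists (l * l'),
  (l * m' + m * l' + m * m' * pi ^+ a - s * s' * (pi ^+ k * gen_norm b c / pi ^+ a)),
  (l * s' + s * pi ^+ k * l' + (m * s' + s * pi ^+ k * m') * pi ^+ a +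
   s * pi ^+ k * s' * (pi ^+ b * t + (c + c))).
have hX := vge_piX hv hpi.
have ht0 : vge v 0 t by apply: vge_le ht _.
have hNa : vge v 0 (pi ^+ k * gen_norm b c / pi ^+ a).
  rewrite (vge_mulr hv _ _ (valuationV hv (hpiX a))) (vge_mulr hv _ _ hN).
  by rewrite (vgeE _ (hpiX k)); lia.
split.
- exact: (vgeMl hv).
- by repeat (done || apply: (vgeB hv) || apply: (vgeD hv) || apply: (vgeMl hv)).
- by repeat (done || apply: (vgeD hv) || apply: (vgeMl hv)).
congr elt; rewrite /gen_norm exprD; last by ring.
by field; rewrite hpiX0.
Qed.

Lemma multiplier_order (a b : nat) c : o c -> vge v a (gen_norm b c) ->
  multiplier_ring (O a b c) = O a b c.
Proof.
move=> hc hN; apply/seteqP; split=> u.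
  by move=> /(_ 1 (@Oabc_1 a b c)); rewrite mulr1.
by move=> hu u' hu'; apply: mem_Oabc_mul.
Qed.

(** * Invertible ideals and units *)

Lemma principal_fractional (R : set E) y z : is_order v R -> y * z = 1 ->
  fractional_ideal R [set y * u | u in R].
Proof.
move=> hR yz; case: (hR) => [[h1 hB hM] hoR _ hs].
have hRo := order_submodule hR.
have hyR : submodule R [set y * u | u in R].
  apply: submoduleP.
  - exists 0; last exact: mulr0. exact: (submod0 hRo).
  - move=> _ _ [u hu <-] [u' hu' <-]; exists (u - u'); rewrite ?mulrBr //.
    exact: (submodB hRo hu hu').
  - move=> r _ hr [u hu <-]; exists (r * u); rewrite 1?mulrCA //.
    by have := hM r u; rewrite !inE; apply.
split=> //.
  exists [:: y]; apply/seteqP; split.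
    move=> _ [u hu <-]; rewrite mulrC; apply: (submodM (generated_submodule _ _)) => //.
    by apply: sub_generated; rewrite /= inE.
  apply: generated_sub => // u; rewrite /= inE => /eqP ->.
  by exists 1; rewrite ?mulr1 //; move: h1; rewrite inE.
apply/(spansP hv hpi (submodule_trans hoR hyR)) => u.
have /(spansP hv hpi hRo) /(_ (z * u)) [k hk] := hs.
by exists k; exists (pi ^+ k *: (z * u)) => //; rewrite -scalerAr mulrA yz mul1r.
Qed.

Lemma principal_invertible (R : set E) y z : is_order v R -> y * z = 1 ->
  invertible_ideal R [set y * u | u in R].
Proof.
move=> hR yz; have zy : z * y = 1 by rewrite mulrC.
exists [set z * u | u in R]; split; first exact: principal_fractional zy.
have [[h1 _ hM] _ _ _] := hR.
have R1 : R 1 by move: h1; rewrite inE.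
have RM u u' : R u -> R u' -> R (u * u').
  by move=> hu hu'; have := hM u u'; rewrite !inE; apply.
have hRR : submodule R R.
  apply: submoduleP => //; first exact: (submod0 (order_submodule hR)).
  by move=> u u'; apply: (submodB (order_submodule hR)).
apply/seteqP; split.
  apply: generated_sub => // _ [_ [u hu <-] [_ [u' hu' <-] <-]].
  by rewrite mulrACA yz mul1r; apply: RM.
move=> u hu; rewrite -[u]mulr1; apply: (submodM (generated_submodule _ _)) => //.
apply: sub_generated; exists y; first by exists 1; rewrite ?mulr1.
by exists z; first by exists 1; rewrite ?mulr1.
Qed.

(** The two norms differ by (c - c') (c + c' + pi^b t), whose second factor has positive valuation.
    This makes v(N) > a a property of the order rather than of the chosen c. *)
Lemma norm_congr (a b : nat) c c' : (0 < a)%N -> vge v 1 c -> vge v a (c - c') ->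
  vge v (a%:Z + 1) (gen_norm b c) = vge v (a%:Z + 1) (gen_norm b c').
Proof.
move=> a0 hc hcc.
have hc' : vge v 1 c'.
  by rewrite -[c'](subKr c); apply: (vgeB hv) => //; apply: vge_le hcc _; lia.
have -> : gen_norm b c = (c - c') * (c + c' + pi ^+ b * t) + gen_norm b c'.
  by rewrite /gen_norm; ring.
rewrite (vge_addl hv) //; apply: (vgeM hv) => //.
by repeat (done || apply: (vgeD hv)); apply: (vgeMl hv) => //; apply: (vge_piX hv hpi).
Qed.

(** This is the locality of the order for a > 0: its nonunits are the elements whose first component
    has positive valuation. The second component is then a unit as well, because q = l + m pi^a and
    both T and the norm have positive valuation. *)
Lemma Oabc_unit (a b : nat) c j : o c -> (0 < a)%N -> vge v 1 c ->
  vge v a (gen_norm b c) -> O a b c j -> ~~ vge v 1 j.1 ->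
  exists2 j', O a b c j' & j * j' = 1.
Proof.
move=> hc a0 hc1 hN /Oabc_gen [l [m [s [hl hm hs ->]]]].
change (~~ vge v 1 l -> exists2 j', O a b c j' &
  elt l (l + m * pi ^+ a + s * c) (s * pi ^+ b) * j' = 1) => hl1.
have vl : v l = 0%:E by apply: val_eq.
pose T := c + c + pi ^+ b * t; pose q := l + m * pi ^+ a.
pose D := q * q + q * s * T + s ^+ 2 * gen_norm b c.
have hX := vge_piX hv hpi.
have hT : vge v 1 T.
  by rewrite /T; repeat (done || apply: (vgeD hv)); apply: (vgeMl hv).
have vq : v q = 0%:E.
  apply: (val_addl hv) => //; apply: (vgeMl hv) => //.
  by rewrite (vgeE _ (hpiX a)); lia.
have oq : vge v 0 q by rewrite (vgeE _ vq).
have vD : v D = 0%:E.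
  rewrite /D -addrA; apply: (val_addl hv).
    by rewrite (valuationM hv) vq -EFinD.
  apply: (vgeD hv); first by apply: (vgeMl hv) => //; apply: (vgeMl hv).
  by apply: (vgeMl hv); [exact: (vgeMl hv)|apply: vge_le hN _; lia].
have D0 := val_neq0 hv vD; have l0 := val_neq0 hv vl.
have oD k y : vge v k (y / D) = vge v k y.
  by rewrite (vge_mulr hv _ _ (valuationV hv vD)) oppr0 subr0.
(* The second component is the conjugate of q + s g divided by its norm D, where g = pi^b x + c has
   trace T. *)
exists (elt l^-1 ((q + s * c + s * pi ^+ b * t) / D) (- (s * pi ^+ b / D))).
  apply/mem_Oabc; split.
  - by rewrite (vgeE _ (valuationV hv vl)).
  - by rewrite (vgeN hv) oD (vge_mulr hv _ _ (hpiX b)) subrr.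
  have -> : (q + s * c + s * pi ^+ b * t) / D - l^-1 -
    - (s * pi ^+ b / D) / pi ^+ b * c =
    (l * (q + s * T) - D) / D / l.
    by rewrite /T; field; rewrite hpiX0 D0 l0.
  (* Divisibility by pi^a becomes visible: q - l = m pi^a, and pi^a divides the norm of g. *)
  have -> : l * (q + s * T) - D =
    - (m * (q + s * T) * pi ^+ a + s ^+ 2 * gen_norm b c).
    by rewrite /D /q; ring.
  rewrite (vge_mulr hv _ _ (valuationV hv vl)) oppr0 subr0 oD (vgeN hv).
  apply: (vgeD hv); last by apply: (vgeMl hv) => //; apply: (vgeMl hv).
  rewrite (vge_mulr hv _ _ (hpiX a)) subrr; apply: (vgeMl hv) => //.
  apply: (vgeD hv) => //; apply: (vgeMl hv) => //; apply: vge_le hT _; lia.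
rewrite elt_mul elt1 -/q; congr elt.
- by rewrite divff.
- have eD : D = (q + s * c) * (q + s * c + s * pi ^+ b * t) + (s * pi ^+ b) ^+ 2 * n.
    by rewrite /D /gen_norm /T; ring.
  transitivity (D / D); last by rewrite divff.
  by rewrite [X in _ = X / D]eD; ring.
- by ring.
Qed.

(** The normalised ideal is some [O a' b' c']. Either it is a ring, hence equal to its multiplier
    ring, and the ideal is principal; or its multiplier ring has a' > 0 and a norm of valuation
    above a', against both alternatives of the assumption. *)
Lemma gorenstein_Oabc a b c : o c -> is_order v (O a b c) ->
  a = 0%N \/ ~~ vge v (a%:Z + 1) (gen_norm b c) -> gorenstein (O a b c).
Proof.
move=> hc hR ha I [hI fgI sI] mI; have [_ hoR _ _] := hR.
have hIo := submodule_trans hoR hI.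
have [k hk] := fg_bounded_OE (Oabc_sub_OE hc) fgI.
have sI' := proj1 (spansP hv hpi hIo) sI.
have [y1 [m1 [[u1 Iu1 <-] hm1 min1]]] : exists y m, [/\ [set u.1 | u in I] y,
    v y = m%:E & forall z, [set u.1 | u in I] z -> vge v m z].
  apply: (val_min hv (k := k%:Z)); first by move=> _ [u /hk [h _] <-].
  have [l hl] := sI' 1; exists (pi ^+ l); last exact: hpiX0.
  by exists (pi ^+ l *: 1) => //; apply: mulr1.
have [y2 [m2 [[u2 Iu2 <-] hm2 min2]]] : exists y m, [/\ [set u.2 | u in I] y,
    w y = m%:E & forall z, [set u.2 | u in I] z -> vge w m z].
  apply: (val_min hw (k := 2 * k%:Z)); first by move=> _ [u /hk [_ h] <-].
  have [l hl] := sI' 1; exists (pi ^+ l *: 1); first by exists (pi ^+ l *: 1).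
  by rewrite scaler_eq0 negb_or hpiX0 oner_neq0.
have {}min1 u : I u -> vge v m1 u.1 by move=> Iu; apply: min1; exists u.
have {}min2 u : I u -> vge w m2 u.2 by move=> Iu; apply: min2; exists u.
(* If u1 and u2 each miss the other minimum, their sum attains both, since in each component one
   summand has strictly larger valuation. *)
have [y [Iy hy1 hy2]] : exists y, [/\ I y, v y.1 = m1%:E & w y.2 = m2%:E].
  have [h|h] := boolP (vge w (m2 + 1) u1.2); last first.
    by exists u1; split=> //; apply: val_eq => //; apply: min2.
  have [h'|h'] := boolP (vge v (m1 + 1) u2.1); last first.
    by exists u2; split=> //; apply: val_eq => //; apply: min1.
  exists (u1 + u2); split; first exact: (submodD hIo).
    exact: (val_addl hv).
  by rewrite addrC; apply: (val_addl hw).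
pose z : E := (y.1^-1, y.2^-1).
have y10 := val_neq0 hv hy1; have y20 := val_neq0 hw hy2.
have yz : y * z = 1 by congr pair; rewrite divff.
pose I' : set E := [set u | I (y * u)].
have I'y u : I u -> I' (z * u) by rewrite /I' /= mulrA yz mul1r.
have hI'o : submodule (scalars E o) I'.
  apply: submodule_scalarsP => [|u u' hu hu'|r u hr hu]; rewrite /I' /=.
  - by rewrite mulr0; apply: (submod0 hIo).
  - by rewrite mulrBr; apply: (submodB hIo).
  - by rewrite -scalerAr; apply: (submodZ hIo).
have [|||a' [b' [c' [hc' e]]]] := normal_form hI'o.
- by rewrite /I' /= mulr1.
- move=> u hu; have -> : u = z * (y * u) by rewrite mulrA [z * y]mulrC yz mul1r.
  split.
    change (vge v 0 (y.1^-1 * (y * u).1)).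
    by rewrite (vge_mull hv _ _ (valuationV hv hy1)) opprK add0r; apply: min1.
  change (vge w 0 (y.2^-1 * (y * u).2)).
  by rewrite (vge_mull hw _ _ (valuationV hw hy2)) opprK add0r; apply: min2.
- apply/(spansP hv hpi hI'o) => u; have [l hl] := sI' (y * u).
  by exists l; rewrite /I' /= -scalerAr.
have mI' : multiplier_ring I' = O a b c.
  rewrite -mI; apply/seteqP; split=> u hu u' hu'.
    by have := hu _ (I'y _ hu'); rewrite /I' /= mulrCA [y * _]mulrA yz mul1r.
  by rewrite /I' /= mulrCA; apply: hu.
have [hN'|hN'] := boolP (vge v a' (gen_norm b' c')).
  have eO : I' = O a b c by rewrite -mI' e multiplier_order.
  suff -> : I = [set y * u | u in O a b c] by apply: principal_invertible yz.
  rewrite -eO; apply/seteqP; split=> u; last by case=> u' hu' <-.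
  by move=> /I'y hu; exists (z * u) => //; rewrite mulrA yz mul1r.
(* Integrality of the norm gives 0 <= j < a', which excludes a = 0. *)
have oN' : vge v 0 (gen_norm b' c').
  have ht0 : vge v 0 t by apply: vge_le ht _.
  rewrite /gen_norm !expr2; have hX := vge_piX hv hpi.
  have on : vge v 0 n by rewrite (vgeE _ hn).
  by repeat (done || apply: (vgeD hv) || apply: (vgeMl hv)).
have [N0|[j hj]] := val_cases hv (gen_norm b' c'); first by rewrite N0 (vge_0 hv) in hN'.
have ja : j < a'%:Z by move: hN'; rewrite (vgeE _ hj) -ltNge.
have j0 : 0 <= j by rewrite -(vgeE _ hj).
pose i := absz (a'%:Z - j).
have hji : v (gen_norm b' c') = (a'%:Z - i%:Z)%:E by rewrite hj; congr _%:E; lia.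
have hci : o (pi ^+ i * c') by apply: (vgeMl hv) => //; apply: (vge_piX hv hpi).
move: mI'; rewrite e (multiplier_Oabc hc' hji) => /(Oabc_eq _ _ _ _ hci hc) [ea eb ec].
(* The valuation is 2 i + (a' - i) = a' + i, with i > 0 and a' = a. *)
have hmore : vge v (a%:Z + 1) (gen_norm (b' + i) (pi ^+ i * c')).
  rewrite norm_piX; have hii : v ((pi ^+ i) ^+ 2) = (2 * i%:Z)%:E.
    by rewrite (valuationXn hv _ (hpiX i)) mulrC.
  by rewrite (vge_mull hv _ _ hii) (vgeE _ hji); lia.
have a0 : (0 < a)%N by lia.
have hc1 : vge v 1 c by apply: vge_le (order_vge_uphalf hc hR) _; lia.
case: ha => [|/negP []]; first by lia.
by rewrite (norm_congr b a0 hc1 (c' := pi ^+ i * c')) -?eb // (vgeBC hv) -ea.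
Qed.

(* The witness is the ideal O_{a, b-k, c pi^-k}, where a + k = v(gen_norm b c);
   adjusting c modulo pi^a first guarantees k <= b and k <= v(c). *)
Lemma Oabc_not_gorenstein a b c : o c -> is_order v (O a b c) -> (0 < a)%N ->
  vge v (a%:Z + 1) (gen_norm b c) -> ~ gorenstein (O a b c).
Proof.
move=> hc hR a0 hN.
have [c' [m [hc' e hm [ma am]]]] : exists c' (m : nat), [/\ o c', O a b c = O a b c',
    v c' = m%:Z%:E & (m <= a)%N /\ (a.+1 <= 2 * m)%N].
  have [ha|ha] := boolP (vge v a c).
    have hX := vge_piX hv hpi a.
    exists (pi ^+ a), a; split=> //; last by split=> //; lia.
    apply/Oabc_eq => //; split=> //; apply: (vgeB hv) => //.
    by rewrite (vgeE _ (hpiX a)).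
  have [c0|[j hj]] := val_cases hv c; first by rewrite c0 (vge_0 hv) in ha.
  have j0 : 0 <= j by rewrite -(vgeE _ hj).
  move: ha hN; rewrite (vgeE _ hj) norm_vge hj -EFinM lee_fin => ha /andP [_ hj2].
  exists c, (absz j); split=> //; first by rewrite hj; congr _%:E; lia.
  by split; lia.
move: hR hN; rewrite {}e norm_vge => hR /andP [hab _].
have [k [k0 kb km hk]] : exists k : nat, [/\ (0 < k)%N, (k <= b)%N, (k <= m)%N &
    v (gen_norm b c') = (a%:Z + k%:Z)%:E].
  (* From m <= a one gets k <= 2 m - a <= m. For m <= b this bounds k by b; for m > b one has a > b,
     so k <= 2 b + 1 - a <= b. *)
  exists (minn (2 * b + 1) (2 * m) - a)%N; split; [lia|lia|lia|].
  by apply: val_eq; rewrite norm_vge hm -EFinM lee_fin; lia.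
pose c2 := c' / pi ^+ k.
have hc2 : o c2.
  change (vge v 0 c2); rewrite (vge_mulr hv _ _ (valuationV hv (hpiX k))) opprK.
  by rewrite (vgeE _ hm); lia.
have ec2 : pi ^+ k * c2 = c' by rewrite mulrC divfK.
have hk2 : v (gen_norm (b - k) c2) = (a%:Z - k%:Z)%:E.
  have -> : gen_norm (b - k) c2 = ((pi ^+ k) ^+ 2)^-1 * gen_norm b c'.
    by rewrite -ec2 -{2}(subnK kb) norm_piX mulKf // expf_neq0.
  rewrite (valuationM hv) hk (valuationV hv (valuationXn hv 2 (hpiX k))) -EFinD.
  by congr _%:E; lia.
have hI := multiplier_Oabc hc2 hk2; move: hI; rewrite subnK // ec2.
set I := O a (b - k) c2 => hI hG.
have [_ hoR _ _] := hR.
have hOI : submodule (O a b c') I.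
  have hIo : submodule (scalars E o) I := Oabc_submodule _ _ _.
  apply: submoduleP; first exact: (submod0 hIo).
    by move=> u u'; apply: (submodB hIo).
  by move=> r u; rewrite -hI; apply.
have [J [[hJ _ _] eJ]] : invertible_ideal (O a b c') I.
  apply: hG => //; split=> //; last exact: Oabc_spans.
  exists [:: (1, 1); (0, (pi ^+ a)%:A); (0, pi ^+ (b - k) *: x + c2%:A)].
  apply/seteqP; split.
    apply: generated_sub; last exact: sub_generated.
    exact: (submodule_trans hoR (generated_submodule _ _)).
  by apply: generated_sub => //; exact: sub_generated.
(* As 1 is in I, J lies in the order. If every element of J had a nonunit first component, the
   product would miss 1; so J contains a unit j, and I = (I j) j^-1 lies in the order, which b - k <
   b forbids. *)
have I1 : I 1 := @Oabc_1 _ _ _.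
have IJ u j : I u -> J j -> O a b c' (u * j).
  by move=> hu hj; rewrite -eJ; apply: sub_generated; exists u => //; exists j.
have JO j : J j -> O a b c' j by move=> /(IJ 1 j I1); rewrite mul1r.
have [j Jj hj] : exists2 j, J j & ~~ vge v 1 j.1.
  apply/not_exists2P => h.
  have : ideal_mul (O a b c') I J `<=` [set u | vge v 1 u.1].
    apply: generated_sub.
      apply: submoduleP => [|u u' hu hu'|r u hr hu].
      - exact: vge_0.
      - exact: (vgeB hv).
      - by apply: (vgeMl hv) => //; have [] := Oabc_sub_OE hc' hr.
    move=> _ [u hu [j hj <-]]; apply: (vgeMl hv).
      by have [] := Oabc_sub_OE hc2 hu.
    by have [|/negP/negPn] := h j.
  rewrite eJ => /(_ 1 (@Oabc_1 _ _ _)); change (vge v 1 1 -> False).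
  by rewrite (vgeE _ (valuation1 hv)).
have hN : vge v a (gen_norm b c') by apply/(Oabc_orderP _ _ hc').
have hc1 : vge v 1 c' by rewrite (vgeE _ hm); lia.
have [j' Oj' jj'] := Oabc_unit hc' a0 hc1 hN (JO _ Jj) hj.
have : I `<=` O a b c'.
  move=> u hu; rewrite -[u]mulr1 -jj' mulrA.
  by apply: mem_Oabc_mul => //; apply: IJ.
by move=> /(Oabc_sub _ _ _ _ _ hc2) [_ bk _]; lia.
Qed.

End Modules.

(** * Classification, inclusions and invariants of the orders *)

Theorem proposition5p4
  (F : fieldType) (ord : F -> \bar int) (pi : F)
  (E' : fieldExtType F) (ordE' : E' -> \bar int) (x : E')
  (hF : nonarchimedean_local_field ord) (hpi : uniformizer ord pi)
  (hquad : \dim {:E'} = 2%N) (hram : ramified ord ordE')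
  (hx : uniformizer ordE' x) :
  let o := valuation_ring ord in
  let O a b c := Oabc ord pi x a b c in
  let OE := max_order ord ordE' in
  let pideal (j : int) := principal_ideal o (pi ^ j) in
  [/\ (* (1) *)
      (forall R : set (prod_alg F E'), is_order ord R ->
         exists (a b : nat) (c : F),
           [/\ o c,
               (a%:Z%:E <= Order.min (2 * b + 1)%N%:Z%:E (2%:E * ord c))%E &
               R = O a b c]) /\
      (forall (a b : nat) (c : F), o c ->
         (a%:Z%:E <= Order.min (2 * b + 1)%N%:Z%:E (2%:E * ord c))%E ->
         is_order ord (O a b c)),
      (* (2) *)
      forall (a b a' b' : nat) (c c' : F), o c -> o c' ->
        is_order ord (O a b c) -> is_order ord (O a' b' c') ->
        (O a b c `<=` O a' b' c' <->
           [/\ (a' <= a)%N, (b' <= b)%N &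
               if (a'%:Z%:E <= ord c)%E
               then pideal (Order.max (uphalf a')%:Z
                              (a'%:Z - (b%:Z - b'%:Z))) c'
               else pideal (a'%:Z - (b%:Z - b'%:Z))
                      (c' - pi ^ (- (b%:Z - b'%:Z)) * c)]) /\
        (O a b c `<=` O a' b' c' -> (ord c < a'%:Z%:E)%E ->
           [/\ ((uphalf a')%:Z%:E <= ord c - (b%:Z - b'%:Z)%:E)%E,
               (ord c - (b%:Z - b'%:Z)%:E)%E = ord c' &
               0 < a'%:Z - (b%:Z - b'%:Z)]),
      (* (3) *)
      forall (a b a' b' : nat) (c c' : F), o c -> o c' ->
        is_order ord (O a b c) -> is_order ord (O a' b' c') ->
        (O a' b' c' = O a b c <-> [/\ a = a', b = b' & pideal a%:Z (c - c')]),
      (* (4) *)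
      forall (a b : nat) (c : F), o c -> is_order ord (O a b c) ->
        quotient_length (scalars (prod_alg F E') o) OE (O a b c) (a + b)%N /\
        conductor OE (O a b c) =
          pideal a%:Z `*`
          principal_ideal (valuation_ring ordE')
            (x ^ fine (Order.max (2 * a)%N%:Z%:E
                         (Order.max (2 * b + 1)%N%:Z%:E
                            ((2 * a + 2 * b)%N%:Z%:E - 2%:E * ord c + 1%:E))
                       - 1%:E)%E) &
      (* (5) *)
      forall (a b : nat) (c : F), o c -> is_order ord (O a b c) ->
        (gorenstein (O a b c) <->
           if (a%:Z%:E <= ord c)%E
           then a = (2 * b + 1)%N \/ a = 0%N
           else a%:Z%:E = Order.min (2 * b + 1)%N%:Z%:E (2%:E * ord c)%E)].
Proof.
move=> o O OE pideal; have [hv _ _] := hF.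
have [t [n [hxx ht hn]]] := eisenstein hv hquad hram hx.
have hw := ramified_norm hram.
have idealE j : pideal j = [set y | vge ord j y] by apply: principal_idealE.
split.
- split=> [|a b c hc]; first exact: (order_form hv hpi hquad hram hx hxx ht hn).
  rewrite (order_criterion hv hpi hquad ht hn).
  by move/(Oabc_orderP hv hpi hquad hram hx hxx ht _ _ hc).
- move=> a b a' b' c c' hc hc' hR hR'; split; last first.
    exact: (order_sub_val hv hpi hquad hram hx hxx ht hn hc hc' hR').
  rewrite !idealE.
  have := order_sub hv hpi hquad hram hx hxx ht hn a b hc hc' hR'.
  by case: ifP.
- move=> a b a' b' c c' hc hc' hR hR'; rewrite idealE.
  have h := Oabc_eq hv hpi hquad hram hx ht a b a' b' hc hc'.
  by split=> [e|e]; [apply/h|symmetry; apply/h].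
- move=> a b c hc hR; split; first exact: (Oabc_length hv hpi hquad hram hx ht).
  rewrite idealE (principal_idealE hw hx).
  exact: (conductor_Oabc hv hpi hquad hram hx hxx ht hn).
move=> a b c hc hR.
have hN := proj1 (Oabc_orderP hv hpi hquad hram hx hxx ht a b hc) hR.
(* An order has v(N) >= a, so the second alternative means v(N) = a. *)
have hG : gorenstein (O a b c) <->
    a = 0%N \/ ~~ vge ord (a%:Z + 1) (gen_norm pi t n b c).
  split=> [hG|]; last exact: (gorenstein_Oabc hv hpi hquad hram hx hxx ht hn hc hR).
  have [->|a0] := posnP a; [by left|right]; apply/negP => hN1.
  exact: (Oabc_not_gorenstein hv hpi hquad hram hx hxx ht hn hc hR a0 hN1 hG).
(* Now v(N) = min(2 b + 1, 2 v(c)) is inserted. If v(c) >= a > 0, then 2 v(c) > a and only 2 b + 1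
   can equal a; if v(c) < a, then a > 0 and the alternative a = 0 disappears. *)
rewrite hG; move: hN.
rewrite !(norm_vge hv hpi hquad ht hn) => /andP [].
have [c0|[m hm]] := val_cases hv c.
  rewrite c0 (valuation0 hv) gt0_muley ?lte_fin // !leey !andbT.
  by move=> ha _; split; lia.
rewrite hm -EFinM !lee_fin; case: ifP => ham ab1 ab2; first by split; lia.
rewrite -EFin_min; split=> [h|[h]]; first by congr _%:E; lia.
by right; lia.
Qed.
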